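(* Let $q\ge 3$ and $3\le m\le 5$ be integers, and let $p_1,p_2,\dots,p_m$ be distinct integers with $0<p_k<q$ for all $k$, with $\gcd(q,p_1,\dots,p_m)=1$, and such that no nonempty proper subset $I\subsetneq\{1,\dots,m\}$ satisfies $\sum_{i\in I}p_i\equiv 0\pmod q$. Let $r_1,\dots,r_m$ be arbitrary integers. Then the sets $\mathcal B_{p_k,r_k}^q$ ($1\le k\le m$) are a perfect covering of $\mathbb Z$ if and only if both of the following hold: (i) $q$ is odd, and $m$ is the multiplicative order of $2$ modulo $q$; (ii) the sets can be renumbered (i.e. the pairs $(p_k,r_k)$ can be permuted) so that there are integers $\delta$ and $\gamma$, with $\delta$ relatively prime to $q$ and $\bar\delta$ denoting an inverse of $\delta$ modulo $q$, such that for all $1\le k\le m$: $$p_k\equiv\delta\,2^{m-k}\pmod q\quad\text{and}\quad r_k\equiv\gamma-\bar\delta\,2^{k-1}\pmod q .$$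
   Context: For integers $p,q\ge 1$ and $r$, $\mathcal B_{p,r}^q:=\{\lfloor nq/p+r\rfloor : n\in\mathbb Z\}$ (a rational Beatty set). Sets $S_1,\dots,S_m\subseteq\mathbb Z$ are a perfect $c$-fold covering of $\mathbb Z$ if every $x\in\mathbb Z$ belongs to exactly $c$ of the sets; they are a perfect covering if they are a perfect $c$-fold covering for some $c$. *)

(* Defs.v *)
From mathcomp Require Import all_boot all_order all_algebra.
From mathcomp Require Import boolp classical_sets.

Set Implicit Arguments.
Unset Strict Implicit.
Unset Printing Implicit Defensive.

Import Order.TTheory GRing.Theory Num.Theory.
Local Open Scope ring_scope.

Definition beatty (p q : nat) (r : int) : set int :=
  range (fun n : int =>
    Num.floor (n%:~R * q%:R / p%:R + r%:~R : rat)).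

Definition perfect_fold_covering (m c : nat) (S : 'I_m -> set int) : Prop :=
  forall x : int, #|[pred k : 'I_m | x \in S k]| = c.

Definition perfect_covering (m : nat) (S : 'I_m -> set int) : Prop :=
  exists c : nat, perfect_fold_covering c S.

Definition is_mult_order (q a e : nat) : Prop :=
  [/\ (0 < e)%N, (a ^ e = 1 %[mod q])%N
    & forall j : nat, (0 < j)%N -> (a ^ j = 1 %[mod q])%N -> (e <= j)%N].

(* Main.v *)
Require Import Defs.
From mathcomp Require Import all_boot all_order all_fingroup all_algebra.
From mathcomp Require Import boolp classical_sets.
From mathcomp Require Import zify ring lra.
From mathcomp Require Import Rstruct complex reals trigo.

(** A point [x] lies in the Beatty set of [(p, r)] iff [p (r - x) mod q < p].
    Take the discrete Fourier transform of a perfect covering at a frequency of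
    exact order [Q], where [Q] is the largest value of [q / gcd (p_k, q)]: only
    the sets attaining [Q] contribute, and the relation they satisfy reads
    [sum_k w^(r_k) / (1 - w^(- 1 / p_k)) = 0] for every primitive [Q]-th root of
    unity [w].  Normalizing [w] so that one chosen term has the largest possible
    modulus [1 / (2 sin (pi / Q))], the triangle inequality bounds it by the sum
    of the numbers [1 / (2 sin (a pi / Q))] for at most four distinct
    [2 <= a <= Q / 2] coprime to [Q].  This forces one of the [a] to be [2],
    except for five sets and small [Q], where a finite search rules out any
    covering.  Hence halving, up to sign, permutes the [p_k] modulo [q], so
    [Q = 2^n - 1] or [Q = 2^n + 1] with [n] the number of contributing sets.
    Since [1 / sin (2 a) = cot a - cot (2 a)], the triangle inequality fails in
    the second case and is an equality in the first; the equality case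
    determines all the phases, that is, signs of the halvings and the [r_k]. *)

Set Implicit Arguments.
Unset Strict Implicit.
Unset Printing Implicit Defensive.

Import Order.TTheory GRing.Theory Num.Theory.
Local Open Scope ring_scope.

(** * Beatty sets as residue conditions *)

(** Distinctness of the [p k] and the absence of pairs with sum [q] make the ratios [p k0 / p k]
    distinct up to sign, so that the numbers [a] are distinct. The zero-sum hypothesis beyond pairs
    enters only at the end, to show that the contributing sets are all the sets; the gcd condition
    then gives [Q = q]. The bound 24 is forced by the estimate with four competing terms: for
    [Q = 23] the values 3, 4, 5, 6 are all coprime to [Q], and their inverse chords sum to slightly
    more than the inverse chord of 1, so the triangle inequality yields no contradiction there. The
    converse implication and the normalization of the finite search rest on a second invariant, the
    sum over all sets of the residues [p (r - x) mod q]. Passing from [x] to [x + 1] lowers this sum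
    by the total of the [p k] and raises it by [q] for each set containing [x]. A covering is
    therefore perfect exactly when the sum of residues is constant. For the powers of two in the
    theorem this sum telescopes. *)

Lemma eqz_modP (q x y : int) :
  (x = y %[mod q])%Z <-> exists t, x = y + t * q.
Proof.
split=> [/eqP|[t ->]]; last by rewrite addrC modzMDl.
by rewrite eqz_mod_dvd => /dvdzP[t xy]; exists t; rewrite -xy addrC subrK.
Qed.

Lemma modz_eqP (q : nat) (x y t : int) :
  (0 <= y < q%:Z) -> x = y + t * q%:Z -> (x %% q)%Z = y.
Proof. by move=> yq ->; rewrite addrC modzMDl modz_small. Qed.

Lemma modz_bound (q : nat) (x : int) : (0 < q)%N -> 0 <= (x %% q)%Z < q%:Z.
Proof. by move=> q0; rewrite modz_ge0 ?ltz_mod //; lia. Qed.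

Definition beatty_resid (p q : nat) (r x : int) : int :=
  ((p%:Z * (r - x)) %% q%:Z)%Z.

Lemma mem_beatty (p q : nat) (r x : int) : (0 < p < q)%N ->
  (x \in beatty p q r) = (beatty_resid p q r x < p%:Z).
Proof.
move=> /andP[p0 pq]; have pR : (0 : rat) < p%:R by rewrite ltr0n.
have floorE n : (Num.floor (n%:~R * q%:R / p%:R + r%:~R : rat) == x) =
    (0 <= n * q%:Z + p%:Z * (r - x) < p%:Z).
  rewrite -[LHS]/(_ == _) floor_eq.
  rewrite -lerBlDr ler_pdivlMr // -ltrBrDr ltr_pdivrMr //.
  have -> : q%:R = (q%:Z)%:~R :> rat by [].
  have -> : p%:R = (p%:Z)%:~R :> rat by [].
  rewrite -!(intrB,intrM,intrD) ler_int ltr_int.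
  by congr andb; lia.
apply/idP/idP.
  rewrite inE => -[n _ /eqP]; rewrite floorE => nP.
  rewrite /beatty_resid (@modz_eqP q _ (n * q%:Z + p%:Z * (r - x)) (- n)); lia.
move=> yp; rewrite inE; exists (- ((p%:Z * (r - x)) %/ q%:Z)%Z) => //.
apply/eqP; rewrite floorE; move: yp; rewrite /beatty_resid.
have := divz_eq (p%:Z * (r - x)) q%:Z.
have := @modz_bound q (p%:Z * (r - x)); lia.
Qed.

(** * The Fourier relation at frequencies of maximal order *)

Lemma sum_periodic_shift (V : nmodType) (q : nat) (h : int -> V) (v : int) :
  (forall x, h (x + q%:Z) = h x) ->
  \sum_(i < q) h (i%:Z + v) = \sum_(i < q) h i%:Z.
Proof.
move=> hq; have step w :
    \sum_(i < q) h (i%:Z + (w + 1)) = \sum_(i < q) h (i%:Z + w).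
  case: q hq => [|q] hq; first by rewrite !big_ord0.
  rewrite big_ord_recr big_ord_recl /= addrC; congr (_ + _).
    by rewrite -[RHS]hq; congr h; lia.
  by apply: eq_bigr => i _; congr h; rewrite /bump /=; lia.
case: v => n; last rewrite NegzE.
  elim: n => [|n IHn]; first by under eq_bigr do rewrite addr0.
  by rewrite -IHn -(step n) -addn1 PoszD.
elim: n => [|n IHn]; rewrite -?IHn -[LHS]step; apply: eq_bigr => i _; congr h; lia.
Qed.

Lemma prim_root_neq0 (F : fieldType) (Q : nat) (w : F) :
  Q.-primitive_root w -> w != 0.
Proof.
move=> wP; rewrite (prim_root_eq0 wP) -lt0n; exact: prim_order_gt0 wP.
Qed.

Lemma exprz_prim_eq1 (F : fieldType) (Q : nat) (w : F) (z : int) :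
  Q.-primitive_root w -> (w ^ z == 1) = (Q%:Z %| z)%Z.
Proof.
move=> wP; have w0 := prim_root_neq0 wP.
case: z => n; first by rewrite -exprnP -(prim_order_dvd wP).
rewrite NegzE -exprnN invr_eq1 -(prim_order_dvd wP).
by rewrite /dvdz /=.
Qed.

Lemma exprz_prim_eq (F : fieldType) (Q : nat) (w : F) (y z : int) :
  Q.-primitive_root w -> (w ^ y == w ^ z) = (Q%:Z %| y - z)%Z.
Proof.
move=> wP; have w0 := prim_root_neq0 wP.
rewrite -(exprz_prim_eq1 _ wP) -{1}[y](subrK z) (expfzDr (y - z)) //.
have wz := expfz_neq0 z w0.
by rewrite -(inj_eq (mulIf wz) (w ^ (y - z))) mul1r.
Qed.

Definition beatty_sum (F : fieldType) (q p : nat) (r : int) (w : F) : F :=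
  \sum_(i < q) (beatty_resid p q r i%:Z < p%:Z)%R%:R * w ^ i%:Z.

Lemma beatty_resid_period (p q : nat) (r x d : int) :
  (q%:Z %| p%:Z * d)%Z -> beatty_resid p q r (x + d) = beatty_resid p q r x.
Proof.
move=> /dvdzP[t pd]; apply/eqz_modP; exists (- t); rewrite mulNr -pd; ring.
Qed.

Lemma exprz_period (F : fieldType) (q Q : nat) (w : F) (x : int) :
  Q.-primitive_root w -> (Q %| q)%N -> w ^ (x + q%:Z) = w ^ x.
Proof.
by move=> wP Qq; apply/eqP; rewrite (exprz_prim_eq _ _ wP) addrAC subrr add0r.
Qed.

(** Since [q] divides [p * d], the indicator has period [d]; shifting the sum by [d] multiplies it
    by [w ^ d], which is not 1. *)
Lemma beatty_sum_eq0 (F : fieldType) (q Q p d : nat) (r : int) (w : F) :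
    Q.-primitive_root w -> (Q %| q)%N -> (q %| p * d)%N -> ~~ (Q %| d)%N ->
  beatty_sum q p r w = 0.
Proof.
move=> wP Qq qpd Qd; have w0 := prim_root_neq0 wP.
pose h (x : int) : F := (beatty_resid p q r x < p%:Z)%R%:R * w ^ x.
have hq x : h (x + q%:Z) = h x.
  by rewrite /h beatty_resid_period ?dvdz_mull // (exprz_period _ wP).
have := sum_periodic_shift d%:Z hq.
under eq_bigr => i _ do
  rewrite /h beatty_resid_period // expfzDr // mulrA.
rewrite -mulr_suml => /eqP; rewrite -subr_eq0 -[X in _ - X]mulr1 -mulrBr.
rewrite mulf_eq0 subr_eq0 (exprz_prim_eq1 _ wP) => /orP[/eqP //|].
by rewrite -[(_ %| _)%Z]/(Q %| d)%N (negPf Qd).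
Qed.

(** All summands with a nonzero coefficient equal [w ^ z]. Their number stays an unevaluated sum
    because only its nonvanishing matters later. *)
Lemma sum_dvd_exprz (F : fieldType) (q Q : nat) (w : F) (z : int) :
    Q.-primitive_root w -> (Q %| q)%N ->
  \sum_(i < q) (Q%:Z %| i%:Z - z)%Z%:R * w ^ i%:Z =
    (\sum_(i < q) (Q %| i)%N)%:R * w ^ z.
Proof.
move=> wP Qq; have w0 := prim_root_neq0 wP.
pose h (x : int) : F := (Q%:Z %| x - z)%Z%:R * w ^ x.
have hq x : h (x + q%:Z) = h x.
  rewrite /h (exprz_period _ wP) // [_ - z]addrAC rpredDr // .
  have := sum_periodic_shift z hq => <-.
rewrite natr_sum mulr_suml; apply: eq_bigr => i _; rewrite /h addrK.
rewrite -[(_ %| _)%Z]/(Q %| i)%N; case: (boolP (Q %| i)%N) => [Qi|];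
  rewrite ?mul0r // expfzDr //.
by move: Qi; rewrite (prim_order_dvd wP) => /eqP wi; rewrite -exprnP wi !mul1r.
Qed.

Lemma multiple_lt (g a b : int) : 0 < g -> a * g < b * g -> a * g <= b * g - g.
Proof.
move=> g0; rewrite ltr_pM2r // => ab.
have -> : b * g - g = (b - 1) * g by ring.
rewrite ler_pM2r //; lia.
Qed.

(** In the application [y] is a multiple of [g] below [q], advanced by one step [g] with wraparound.
    The condition [y < p] can only start to hold at the wrap from [q - g] to 0, and can only cease
    to hold at [p - g]. *)
Lemma step_indicator (F : pzRingType) (y p q g : int) :
    0 < p -> 0 < g -> y <= q - g -> p <= q - g -> (y < p -> y <= p - g) ->
  ((if y == q - g then 0 else y + g) < p)%R%:R - (y < p)%R%:R =
    (y == q - g)%:R - (y == p - g)%:R :> F.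
Proof.
move=> p0 g0 yqg pqg yp; case: eqP => [yE|yE].
  have -> : (y < p) = false by lia.
  have -> : (y == p - g) = false by lia.
  by rewrite p0.
have [ylt|yge] := ltrP y p; last first.
  have -> : (y == p - g) = false by lia.
  by have -> : (y + g < p) = false by lia.
have [->|yne] := eqVneq y (p - g); first by rewrite subrK ltxx.
have -> : (y + g < p) = true by have := yp ylt; lia.
by rewrite subrr subr0.
Qed.

(** A summation by parts. Moving [x] by [- v] adds [g] to the residue, one step on the cycle of
    multiples of [g]. The indicator and its shift thus differ only on two adjacent classes modulo
    [Q], which contribute [w ^ (r + v)] and [w ^ (r + v - 1)]. *)
Lemma beatty_sumE (F : fieldType) (q Q g p : nat) (r v : int) (w : F) :
    Q.-primitive_root w -> q = (g * Q)%N -> (0 < p < q)%N -> (g %| p)%N ->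
    (p%:Z * v = g%:Z %[mod q%:Z])%Z ->
  beatty_sum q p r w * (w ^ v - 1) =
    (\sum_(i < q) (Q %| i)%N)%:R * (w ^ (r + v) * (1 - w ^-1)).
Proof.
move=> wP qE /andP[p0 pq] gp /eqz_modP[t pv]; have w0 := prim_root_neq0 wP.
have Qq : (Q %| q)%N by rewrite qE dvdn_mull.
pose h (x : int) : F := (beatty_resid p q r x < p%:Z)%R%:R * w ^ (x + v).
have hq x : h (x + q%:Z) = h x.
  rewrite /h beatty_resid_period ?dvdz_mull // addrAC.
  by rewrite (exprz_period _ wP).
have key x : (beatty_resid p q r (x - v) < p%:Z)%R%:R -
             (beatty_resid p q r x < p%:Z)%R%:R =
             (Q%:Z %| x - (r + v))%Z%:R - (Q%:Z %| x - (r - 1 + v))%Z%:R :> F.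
  have g0 : (0 < g)%N by case: (g) gp => //; rewrite dvd0n => /eqP p00; lia.
  have /dvdnP[p' pE] := gp.
  (* [v] inverts [p / g] modulo [Q], so divisibility of [y] by [Q] can be tested on [p * y] modulo
     [q]. *)
  have resid0 : forall y : int, (Q%:Z %| y)%Z = (q%:Z %| p%:Z * y)%Z.
    move=> y; apply/idP/idP => /dvdzP[s sE].
      by apply/dvdzP; exists (p'%:Z * s); rewrite sE qE pE !PoszM; ring.
    apply/dvdzP; exists (v * s - t * y).
    apply: (@mulfI _ g%:Z); first by rewrite gt_eqF.
    have -> : g%:Z * y = (p%:Z * v - t * q%:Z) * y by rewrite pv; ring.
    have -> : (p%:Z * v - t * q%:Z) * y = v * (p%:Z * y) - t * q%:Z * y by ring.
    by rewrite sE qE PoszM; ring.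
  have divq0 y : - q%:Z < y < q%:Z -> (q%:Z %| y)%Z = (y == 0).
    move=> yq; apply/idP/eqP => [/dvdzP[s sE]|->]; last exact: dvdz0.
    have : s = 0 by nia.
    by move=> s0; rewrite sE s0 mul0r.
  have divD y z s : y = z + s * q%:Z -> (q%:Z %| y)%Z = (q%:Z %| z)%Z.
    by move=> ->; rewrite rpredDr // dvdz_mull.
  set y := beatty_resid p q r x.
  have y_bound : 0 <= y < q%:Z by apply: modz_bound; lia.
  have yE : p%:Z * (r - x) = (p%:Z * (r - x) %/ q%:Z)%Z * q%:Z + y
    by rewrite -divz_eq.
  have [y0 y0E] : exists y0, y = y0 * g%:Z.
    exists (p'%:Z * (r - x) - (p%:Z * (r - x) %/ q%:Z)%Z * Q%:Z).
    move: yE; set u := (_ %/ _)%Z; rewrite {1}pE qE !PoszM => yE.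
    have -> : y = p'%:Z * g%:Z * (r - x) - u * (g%:Z * Q%:Z) by rewrite yE; ring.
    by ring.
  have yqg : y <= q%:Z - g%:Z.
    have [_] := andP y_bound; rewrite y0E qE PoszM [g%:Z * _]mulrC.
    exact: multiple_lt.
  have -> : (Q%:Z %| x - (r + v))%Z = (y == q%:Z - g%:Z).
    rewrite resid0 (divD _ (q%:Z - g%:Z - y) (- (p%:Z * (r - x) %/ q%:Z)%Z - t - 1)).
      by rewrite divq0; [lia|lia].
    have -> : p%:Z * (x - (r + v)) = - (p%:Z * (r - x)) - p%:Z * v by ring.
    by rewrite pv {1}yE; ring.
  have -> : (Q%:Z %| x - (r - 1 + v))%Z = (y == p%:Z - g%:Z).
    rewrite resid0 (divD _ (p%:Z - g%:Z - y) (- (p%:Z * (r - x) %/ q%:Z)%Z - t)).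
      by rewrite divq0; [lia|lia].
    have -> : p%:Z * (x - (r - 1 + v)) = - (p%:Z * (r - x)) - p%:Z * v + p%:Z by ring.
    by rewrite pv {1}yE; ring.
  have pg : y < p%:Z -> y <= p%:Z - g%:Z.
    by rewrite y0E pE PoszM; exact: multiple_lt.
  have pqg : p%:Z <= q%:Z - g%:Z.
    move: pq; rewrite -ltz_nat pE qE !PoszM [g%:Z * _]mulrC.
    exact: multiple_lt.
  have -> : beatty_resid p q r (x - v) = if y == q%:Z - g%:Z then 0 else y + g%:Z.
    rewrite /beatty_resid; set u := (p%:Z * (r - x) %/ q%:Z)%Z in yE.
    have xv : p%:Z * (r - (x - v)) = y + g%:Z + (u + t) * q%:Z.
      have -> : p%:Z * (r - (x - v)) = p%:Z * (r - x) + p%:Z * v by ring.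
      by rewrite pv {1}yE; ring.
    case: eqP => yqg'; first by rewrite xv yqg'; apply: (@modz_eqP _ _ _ (u + t + 1)); [lia|ring].
    by apply: modz_eqP xv; lia.
  by exact: step_indicator.
have := sum_periodic_shift (- v) hq.
rewrite /beatty_sum mulrBr mulr1 mulr_suml.
have -> : \sum_(i < q) h i%:Z = \sum_(i < q)
   (beatty_resid p q r i%:Z < p%:Z)%R%:R * w ^ i%:Z * w ^ v.
  by apply: eq_bigr => i _; rewrite /h expfzDr // mulrA.
move=> <-; rewrite -sumrB.
under eq_bigr => i _ do rewrite /h subrK -mulrBl key mulrBl.
rewrite sumrB !sum_dvd_exprz //.
have -> : r - 1 + v = r + v - 1 by ring.
by rewrite (expfzDr (r + v)) // exprN1 -mulrBr [in RHS]mulrBr mulr1.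
Qed.

Lemma beatty_coverE (q m c : nat) (p : 'I_m -> nat) (r : 'I_m -> int) :
    (forall k, 0 < p k < q)%N ->
  perfect_fold_covering c (fun k => beatty (p k) q (r k)) <->
  (forall x, \sum_k (beatty_resid (p k) q (r k) x < (p k)%:Z)%R = c)%N.
Proof.
move=> p_range.
have E x : #|[pred k | x \in beatty (p k) q (r k)]| =
    (\sum_k (beatty_resid (p k) q (r k) x < (p k)%:Z)%R)%N.
  rewrite -sum1_card big_mkcond; apply: eq_bigr => k _.
  by rewrite inE mem_beatty //; case: ltP.
by split=> h x; rewrite -(h x) E.
Qed.

(** The additive order of [p] modulo [q], hence the least period of [beatty_resid p q r]. *)
Definition period (q p : nat) : nat := (q %/ gcdn p q)%N.

(** Added over all sets, the transforms give [c] times a full sum of powers of [w], which is 0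
    because [w] is not 1. The surviving terms share a nonzero factor, the count times [1 - w^-1],
    which cancels. *)
Lemma beatty_fourier (F : numFieldType) (q Q g m c : nat) (p : 'I_m -> nat)
    (r v : 'I_m -> int) (w : F) :
    Q.-primitive_root w -> (1 < Q)%N -> (0 < g)%N -> q = (g * Q)%N ->
    (forall k, 0 < p k < q)%N ->
    (forall k, period q (p k) <= Q)%N ->
    (forall k, period q (p k) = Q ->
       ((p k)%:Z * v k = g%:Z %[mod q%:Z])%Z) ->
    perfect_fold_covering c (fun k => beatty (p k) q (r k)) ->
  \sum_(k | period q (p k) == Q) w ^ (r k + v k) / (w ^ v k - 1) = 0.
Proof.
move=> wP Q1 g0 qE p_range Qmax vP /beatty_coverE-/(_ p_range) cov.
have w0 := prim_root_neq0 wP.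
have w1 : w != 1.
  by rewrite -[w]expr1 -(prim_order_dvd wP) dvdn1 gtn_eqF.
have Qq : (Q %| q)%N by rewrite qE dvdn_mull.
have q0 : (0 < q)%N by rewrite qE muln_gt0 g0 (prim_order_gt0 wP).
have tot : \sum_k beatty_sum q (p k) (r k) w = 0.
  rewrite /beatty_sum exchange_big /=.
  under eq_bigr => i _ do rewrite -mulr_suml -natr_sum cov.
  rewrite -mulr_sumr; apply/eqP; rewrite mulf_eq0; apply/orP; right.
  have := sum_periodic_shift 1 (fun x => exprz_period x wP Qq).
  under eq_bigr => i _ do rewrite expfzDr // expr1z.
  rewrite -mulr_suml => /eqP; rewrite -subr_eq0 -[X in _ - X]mulr1 -mulrBr.
  by rewrite mulf_eq0 subr_eq0 (negPf w1) orbF.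
have kappa : (\sum_(i < q) (Q %| i)%N)%:R != 0 :> F.
  rewrite pnatr_eq0 -lt0n; case: (q) q0 => // q' _.
  by rewrite big_ord_recl dvdn0.
have w1' : 1 - w^-1 != 0 by rewrite subr_eq0 eq_sym invr_eq1.
apply: (mulfI kappa); apply: (mulfI w1'); rewrite !mulr0 -[RHS]tot.
rewrite [RHS](bigID (fun k => period q (p k) == Q)) /=.
(* A positive period below [Q] is not divisible by [Q], so [beatty_sum_eq0] applies with the period
   as [d]. *)
rewrite [X in _ = _ + X]big1 ?addr0; last first.
  move=> k kK; have d0 : (0 < period q (p k))%N.
    by rewrite /period divn_gt0 ?gcdn_gt0 ?q0 ?orbT // dvdn_leq ?dvdn_gcdr.
  apply: (@beatty_sum_eq0 _ q Q _ (period q (p k))) => //.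
    by rewrite /period muln_divA ?dvdn_gcdr // -/(lcmn _ _) dvdn_lcmr.
  apply: contra kK => QD; rewrite eqn_leq Qmax /=; exact: dvdn_leq.
rewrite !mulr_sumr; apply: eq_bigr => k /eqP kK.
have gp : (g %| p k)%N.
  have gd : (g = gcdn (p k) q)%N.
    have := divnK (dvdn_gcdr (p k) q); rewrite -/(period q (p k)) kK {2}qE mulnC => /eqP.
    by rewrite eqn_pmul2r ?(prim_order_gt0 wP) // => /eqP.
  by rewrite gd dvdn_gcdl.
have := beatty_sumE (r k) wP qE (p_range k) gp (vP k kK).
have vk1 : w ^ v k - 1 != 0.
  rewrite subr_eq0 (exprz_prim_eq1 _ wP); apply/negP => /dvdzP[s sE].
  have /eqz_modP[t tE] := vP k kK.
  have /dvdnP[p' pE] := gp.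
  have : (Q%:Z %| 1)%Z.
    apply/dvdzP; exists (p'%:Z * s - t).
    apply: (@mulfI _ g%:Z); first by rewrite gt_eqF.
    transitivity ((p k)%:Z * v k - t * q%:Z); first by rewrite tE; ring.
    by rewrite sE pE qE !PoszM; ring.
  by rewrite dvdz1 gtn_eqF.
move=> /(canRL (mulfK vk1)) ->; ring.
Qed.

(** * Roots of unity and chords *)

Lemma unit_sum_triangle (R : rcfType) (I : finType) (P : pred I) (i0 : I)
    (u : I -> R[i]) (s : I -> R) :
    P i0 -> (forall i, P i -> `|u i| = 1) ->
    \sum_(i | P i) u i * (s i)%:C%C = 0 ->
  `|s i0| <= \sum_(i | P i && (i != i0)) `|s i|.
Proof.
move=> Pi0 u1 /eqP; rewrite (bigD1 i0) //= addr_eq0 => /eqP sum0.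
have normu i : P i -> `|u i * (s i)%:C%C| = `|s i|%:C%C.
  by move=> Pi; rewrite normrM u1 // mul1r normc_def /= expr0n addr0 sqrtr_sqr.
rewrite -lecR -normu // sum0 normrN (le_trans (ler_norm_sum _ _ _)) //.
rewrite rmorph_sum /= le_eqVlt; apply/orP; left; apply/eqP.
by apply: eq_bigr => i /andP[Pi _]; rewrite normu.
Qed.

(** Equality in the triangle inequality puts all terms other than that of [i0] on one ray, opposite
    to the term of [i0]; a real weight affects the direction only through its sign. *)
Lemma unit_sum_triangle_eq (R : rcfType) (I : finType) (P : pred I) (i0 i : I)
    (u : I -> R[i]) (s : I -> R) :
    P i0 -> (forall i, P i -> `|u i| = 1) ->
    \sum_(i | P i) u i * (s i)%:C%C = 0 ->
    `|s i0| = \sum_(i | P i && (i != i0)) `|s i| -> 0 < s i0 ->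
    P i -> i != i0 -> s i != 0 ->
  u i = - ((Num.sg (s i))%:C)%C * u i0.
Proof.
move=> Pi0 u1 sum0 seq s0 Pi ii0 si0; move: sum0 => /eqP.
rewrite (bigD1 i0) //= addr_eq0 => /eqP sum0.
have normu j : P j -> `|u j * (s j)%:C%C| = `|s j|%:C%C.
  by move=> Pj; rewrite normrM u1 // mul1r normc_def /= expr0n addr0 sqrtr_sqr.
have := @normC_sum_eq R[i] I (fun j => P j && (j != i0)) (fun j => u j * (s j)%:C%C).
rewrite -[X in `|X|]opprK -sum0 normrN normu // seq rmorph_sum /=.
case=> [|t _ tP]; first by apply: eq_bigr => j /andP[Pj _]; rewrite normu.
have s0C : `|s i0|%:C%C != 0 by rewrite fmorph_eq0 normr_eq0 gt_eqF.
have u0E : u i0 = - t.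
  apply: (mulIf s0C); rewrite -{1}(gtr0_norm s0) in sum0; rewrite sum0 mulNr.
  congr (- _); rewrite seq rmorph_sum mulr_sumr; apply: eq_bigr => j /andP[Pj ji].
  by rewrite tP ?Pj // normu // mulrC.
have := tP i; rewrite Pi ii0 normu // => /(_ isT).
have sC : (s i)%:C%C != 0 by rewrite fmorph_eq0.
move=> usi; apply: (mulIf sC); rewrite usi normrEsg rmorphM /= u0E; ring.
Qed.

Definition cis (R : realType) (t : R) : R[i] := (cos t +i* sin t)%C.

Lemma cisD (R : realType) (a b : R) : cis (a + b) = cis a * cis b.
Proof.
by rewrite /cis cosD sinD; apply/eqP; rewrite eq_complex /= eqxx addrC eqxx.
Qed.

Lemma cis0 (R : realType) : cis (0 : R) = 1.
Proof. by rewrite /cis cos0 sin0. Qed.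

Lemma norm_cis (R : realType) (a : R) : `|cis a| = 1.
Proof. by rewrite normc_def /= cos2Dsin2 sqrtr1. Qed.

Lemma cis_neq0 (R : realType) (a : R) : cis a != 0.
Proof. by rewrite -normr_eq0 norm_cis oner_eq0. Qed.

Lemma cisN (R : realType) (a : R) : cis (- a) = (cis a)^-1.
Proof.
have ca := cis_neq0 a.
by apply: (mulIf ca); rewrite mulVf // -cisD addNr cis0.
Qed.

Lemma cis_exprz (R : realType) (a : R) (z : int) : cis a ^ z = cis (a * z%:~R).
Proof.
have nat_case n : cis a ^+ n = cis (a * n%:R).
  elim: n => [|n IHn]; first by rewrite mulr0 cis0.
  by rewrite exprS IHn -cisD -natr1; congr cis; ring.
case: z => n; first by rewrite -exprnP nat_case.
rewrite NegzE -exprnN nat_case -cisN mulrNz mulrN; by [].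
Qed.

Lemma cisB (R : realType) (a : R) : cis a - (cis a)^-1 = 2 * 'i%C * (sin a)%:C%C.
Proof.
rewrite -cisN /cis cosN sinN; apply/eqP; rewrite eq_complex /=.
by apply/andP; split; apply/eqP; ring.
Qed.

(* [chord Q z] is half the length of the chord between the points [1] and
   [e^(2 pi i z / Q)], up to sign. *)
Definition chord (R : realType) (Q : nat) (z : int) : R :=
  sin (pi / Q%:R * z%:~R).

(** Half of the angle [2 pi / Q] is used so that [eta ^ (2 z) - 1] splits into the phase [eta ^ z]
    and the real number [chord Q z], up to the factor [2 i]. *)
Definition eta (R : realType) (Q : nat) : R[i] := cis (pi / Q%:R).

Lemma eta_order (R : realType) (Q : nat) : (0 < Q)%N -> eta R Q ^+ Q = -1.
Proof.
move=> Q0; rewrite -[LHS]/(eta R Q ^ Q%:Z) cis_exprz.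
rewrite -mulrA mulVf ?mulr1 ?pnatr_eq0 -?lt0n // /cis cospi sinpi.
by apply/eqP; rewrite eq_complex /= oppr0 !eqxx.
Qed.

Lemma chord_gt0 (R : realType) (Q a : nat) : (0 < a < Q)%N -> 0 < chord R Q a.
Proof.
move=> /andP[a0 aQ]; have Q0 : (0 : R) < Q%:R by rewrite ltr0n; lia.
have Qn : (0 < Q)%N by lia.
apply: sin_gt0_pi; rewrite mulr_gt0 ?divr_gt0 ?pi_gt0 ?ltr0n //=.
by rewrite mulrAC ltr_pdivrMr // ltr_pM2l ?pi_gt0 // ltr_nat.
Qed.

Lemma chordDQ (R : realType) (Q : nat) (z : int) : (0 < Q)%N ->
  chord R Q (z + Q%:Z) = - chord R Q z.
Proof.
move=> Q0; rewrite /chord -sinDpi intrD mulrDr; congr (sin (_ + _)).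
by rewrite -mulrA mulVf ?mulr1 // pnatr_eq0 -lt0n.
Qed.

Lemma chordN (R : realType) (Q : nat) (z : int) : chord R Q (- z) = - chord R Q z.
Proof. by rewrite /chord mulrNz mulrN sinN. Qed.

Lemma norm_chord_mod (R : realType) (Q : nat) (z : int) : (0 < Q)%N ->
  `|chord R Q z| = `|chord R Q (z %% Q%:Z)%Z|.
Proof.
move=> Q0; have step y : `|chord R Q (y + Q%:Z)| = `|chord R Q y|.
  by rewrite chordDQ // normrN.
have stepn y n : `|chord R Q (y + n%:Z * Q%:Z)| = `|chord R Q y|.
  elim: n => [|n IHn]; first by rewrite mul0r addr0.
  by rewrite -IHn -[RHS]step; congr (`|chord R Q _|); lia.
rewrite {1}(divz_eq z Q%:Z) addrC; case: (z %/ Q%:Z)%Z => n; first exact: stepn.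
rewrite -(stepn _ n.+1) NegzE; congr (`|chord R Q _|); ring.
Qed.

(** The imaginary part of [eta ^ n] is [chord Q n]; for [0 < n < 2 Q] it vanishes only at [n = Q],
    where the power is -1. *)
Lemma eta_prim (R : realType) (Q : nat) : (0 < Q)%N ->
  (Q.*2).-primitive_root (eta R Q).
Proof.
move=> Q0; have QR : Q%:R != 0 :> R by rewrite pnatr_eq0 -lt0n.
rewrite /primitive_root_of_unity double_gt0 Q0 /=; apply/forallP => i.
have [iE|iE] := eqVneq i.+1 Q.*2.
  rewrite iE unity_rootE -addnn exprD eta_order // mulrNN mulr1 !eqxx; done.
have iQ : (i.+1 < Q.*2)%N by rewrite ltn_neqAle iE ltn_ord.
rewrite unity_rootE; apply/eqP/negbTE/negP => /eqP e1.
have chord0 : chord R Q i.+1 = 0.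
  by have := cis_exprz (pi / Q%:R : R) i.+1; rewrite -exprnP e1 => -[].
case: (ltngtP i.+1 Q) => iQ'.
- by have := @chord_gt0 R Q i.+1; rewrite chord0 ltxx iQ' => /(_ isT).
- have := @chord_gt0 R Q (i.+1 - Q); have := @chordDQ R Q (i.+1 - Q)%N Q0.
  rewrite -PoszD subnK; last by lia.
  by rewrite chord0 => /esym/eqP; rewrite oppr_eq0 => /eqP ->; rewrite ltxx; lia.
- by move: e1; rewrite iQ' eta_order // => /eqP; rewrite eq_complex /=; lra.
Qed.

(** * Chord estimates *)

(** Induction on the size: among [n + 1] distinct entries from [lo] on, one is at least [lo + n] by
    pigeonhole, and its value is bounded by the last term on the right. *)
Lemma sum_antitone (R : numDomainType) (f : nat -> R) (lo hi : nat) (s : seq nat) :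
    (forall a b, (lo <= a)%N -> (a <= b)%N -> (b <= hi)%N -> f b <= f a) ->
    uniq s -> all (fun a => lo <= a <= hi)%N s ->
  \sum_(a <- s) f a <= \sum_(i < size s) f (lo + i)%N.
Proof.
move=> f_anti; move: {2}(size s) (erefl (size s)) => n.
elim: n s => [|n IHn] s sn su sb.
  by rewrite (size0nil sn) big_nil big_ord0.
have [a sa na] : exists2 a, a \in s & (lo + n <= a)%N.
  apply/hasP; apply: contraT => /hasPn small.
  have /uniq_leq_size -/(_ su) : {subset s <= iota lo n}.
    move=> b bs; rewrite mem_iota; have := allP sb b bs.
    by have := small b bs; rewrite -ltnNge => -> /andP[->].
  by rewrite size_iota sn ltnn.
rewrite (perm_big _ (perm_to_rem sa)) big_cons sn big_ord_recr /= addrC.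
have /andP[_ ahi] := allP sb a sa.
rewrite lerD ?f_anti ?leq_addr //.
have srem : size (rem a s) = n by rewrite size_rem // sn.
have := IHn _ srem; rewrite srem; apply; first exact: rem_uniq.
apply/allP => b /mem_rem; exact: (allP sb).
Qed.

Lemma chord_rec (R : realType) (Q n : nat) :
  chord R Q n.+2 = 2 * cos (pi / Q%:R) * chord R Q n.+1 - chord R Q n.
Proof.
rewrite /chord; set x := pi / Q%:R.
have -> : x * n.+2%:~R = x * n.+1%:~R + x.
  by rewrite -!pmulrn -[n.+2%:R]natr1; ring.
have -> : x * n%:~R = x * n.+1%:~R - x by rewrite -!pmulrn -[n.+1%:R]natr1; ring.
rewrite sinD sinB; ring.
Qed.

Lemma chord_mono (R : realType) (Q a b : nat) : (a < b)%N -> (b.*2 <= Q)%N ->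
  chord R Q a < chord R Q b.
Proof.
move=> ab bQ; have Q0 : (0 : R) < Q%:R by rewrite ltr0n; lia.
have pi0 := pi_gt0 R.
have half n : (n.*2 <= Q)%N -> pi / Q%:R * n%:R <= pi / 2 :> R.
  move=> nQ; rewrite mulrAC ler_pdivrMr // mulrAC ler_pdivlMr //.
  by rewrite -mulrA ler_pM2l // -natrM ler_nat; lia.
have pos n : - (pi / 2) <= pi / Q%:R * n%:R :> R.
  apply: (@le_trans _ _ 0); first by rewrite oppr_le0 divr_ge0 // ltW.
  by rewrite mulr_ge0 // divr_ge0 // ltW.
rewrite /chord ltr_sin ?in_itv /= ?pos ?half //; last by lia.
by rewrite ltr_pM2l ?divr_gt0 // ltr_nat.
Qed.

Lemma cos_pi_div_mono (R : realType) (a b : nat) : (0 < a <= b)%N ->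
  cos (pi / a%:R) <= cos (pi / b%:R) :> R.
Proof.
move=> /andP[a0 ab]; have pi0 := pi_gt0 R.
have aR : (1 : R) <= a%:R by rewrite ler1n.
have bR : (a%:R : R) <= b%:R by rewrite ler_nat.
have ran (y : R) : 1 <= y -> 0 <= pi / y <= pi.
  move=> y1; have y0 : 0 < y by lra.
  by rewrite divr_ge0 ?(ltW pi0) ?(ltW y0) // ler_pdivrMr // ler_peMr // ltW.
rewrite leNgt ltr_cos ?in_itv /= ?ran //; last by lra.
by rewrite -leNgt ler_pM2l // lef_pV2 // posrE; lra.
Qed.

Lemma cos_half (R : realType) (n : nat) : (0 < n)%N ->
  4 * cos (pi / (n.*2)%:R) ^+ 2 = 2 + 2 * cos (pi / n%:R) :> R.
Proof.
move=> n0; have nR : n%:R != 0 :> R by rewrite pnatr_eq0 -lt0n.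
have -> : pi / n%:R = (pi / (n.*2)%:R) *+ 2 :> R.
  by rewrite -muln2 natrM; field.
by rewrite cos_mulr2n; ring.
Qed.

Lemma cos_third (R : realType) (n : nat) : (0 < n)%N ->
  (2 * cos (pi / (n * 3)%:R)) ^+ 3 - 3 * (2 * cos (pi / (n * 3)%:R)) =
    2 * cos (pi / n%:R) :> R.
Proof.
move=> n0; have nR : n%:R != 0 :> R by rewrite pnatr_eq0 -lt0n.
set x := pi / (n * 3)%:R.
have -> : pi / n%:R = x *+ 2 + x :> R.
  by rewrite /x natrM; field.
rewrite cosD cos_mulr2n sin_mulr2n.
have -> : (cos x * sin x) *+ 2 * sin x = 2 * cos x * (1 - cos x ^+ 2).
  by rewrite -sin2cos2; ring.
ring.
Qed.

Lemma cos_pi1 (R : realType) : cos (pi / 1%:R) = -1 :> R.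
Proof. by rewrite divr1 cospi. Qed.

Lemma cos_pi_div_gt0 (R : realType) (n : nat) : (2 < n)%N ->
  0 < cos (pi / n%:R) :> R.
Proof.
move=> n2; have pi0 := pi_gt0 R; have nR : (3 : R) <= n%:R by rewrite ler_nat.
apply: cos_gt0_pihalf; apply/andP; split.
  by apply: (@lt_trans _ _ 0); rewrite ?oppr_lt0 divr_gt0 //; lra.
by rewrite ltr_pM2l // ltf_pV2 ?posrE; lra.
Qed.

Lemma cos_pi3 (R : realType) : 2 * cos (pi / 3%:R) = 1 :> R.
Proof.
have := @cos_third R 1 isT; have := @cos_pi_div_gt0 R 3 isT.
rewrite cos_pi1 mul1n; set y := cos _ => y0 yE.
(* The triple-angle formula at [pi] reads [4 y^3 - 3 y = -1], which factors in this way. *)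
have : (y + 1) * (2 * y - 1) ^+ 2 = 0 by lra.
move=> /eqP; rewrite mulf_eq0 expf_eq0 /= => /orP[] /eqP; lra.
Qed.

Lemma cos_pi6_ge (R : realType) : 1732 / 1000 <= 2 * cos (pi / 6%:R) :> R.
Proof.
have h : 4 * cos (pi / 6%:R) ^+ 2 = 2 + 2 * cos (pi / 3%:R) :> R.
  exact: (@cos_half R 3).
have := @cos_pi_div_gt0 R 6 isT; have := cos_pi3 R; move: h.
set y := cos (_ / 6%:R); set z := cos _ => *; nra.
Qed.

Lemma cos_pi24_ge (R : realType) : 19828 / 10000 <= 2 * cos (pi / 24%:R) :> R.
Proof.
have h12 : 4 * cos (pi / 12%:R) ^+ 2 = 2 + 2 * cos (pi / 6%:R) :> R.
  exact: (@cos_half R 6).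
have h24 : 4 * cos (pi / 24%:R) ^+ 2 = 2 + 2 * cos (pi / 12%:R) :> R.
  exact: (@cos_half R 12).
have := cos_pi6_ge R; have := @cos_pi_div_gt0 R 12 isT.
have := @cos_pi_div_gt0 R 24 isT; move: h12 h24.
set x := cos (_ / 24%:R); set y := cos (_ / 12%:R); set z := cos _.
move=> h12 h24 x0 y0 z1; have y1 : 19318 / 10000 <= 2 * y by nra.
nra.
Qed.

(** 27 is reached from 3 by two trisections. The cubic [t^3 - 3 t] is increasing for [t >= 1], so a
    lower bound on its value gives one on [t]. *)
Lemma cos_pi27_ge (R : realType) : 1986 / 1000 <= 2 * cos (pi / 27%:R) :> R.
Proof.
have h9 : (2 * cos (pi / 9%:R)) ^+ 3 - 3 * (2 * cos (pi / 9%:R)) = 1 :> R.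
  by rewrite -[RHS]cos_pi3; exact: (@cos_third R 3).
have h27 : (2 * cos (pi / 27%:R)) ^+ 3 - 3 * (2 * cos (pi / 27%:R)) =
    2 * cos (pi / 9%:R) :> R by exact: (@cos_third R 9).
have := cos_pi6_ge R; have := @cos_pi_div_mono R 6 9 isT.
have := @cos_pi_div_mono R 6 27 isT; move: h9 h27.
set x := cos (_ / 27%:R); set y := cos (_ / 9%:R); set z := cos _.
move=> h9 h27 zx zy z1.
have inc (a b : R) : 1 <= a -> a < b -> a ^+ 3 - 3 * a < b ^+ 3 - 3 * b.
  move=> a1 ab; have -> : b ^+ 3 - 3 * b =
    a ^+ 3 - 3 * a + (b - a) * (b ^+ 2 + a * b + a ^+ 2 - 3) by ring.
  rewrite ltrDl mulr_gt0 ?subr_gt0 //; nra.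
have y1 : 1879 / 1000 <= 2 * y.
  by rewrite leNgt; apply/negP => /inc; lra.
by rewrite leNgt; apply/negP => /inc; lra.
Qed.

(** The ratios to [chord R Q 1] are Chebyshev polynomials of the second kind at [c / 2], so the
    chord estimates reduce to lower bounds on [c]. *)
Lemma chord_small (R : realType) (Q : nat) (c := 2 * cos (pi / Q%:R) : R) :
  [/\ chord R Q 3 = chord R Q 1 * (c ^+ 2 - 1),
      chord R Q 4 = chord R Q 1 * (c * (c ^+ 2 - 2)),
      chord R Q 5 = chord R Q 1 * (c ^+ 2 * (c ^+ 2 - 3) + 1),
      chord R Q 6 = chord R Q 1 * (c * (c ^+ 2 - 1) * (c ^+ 2 - 3)) &
      chord R Q 7 = chord R Q 1 * (c ^+ 2 * (c ^+ 2 - 2) * (c ^+ 2 - 3) - 1)].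
Proof.
have chord0 : chord R Q 0 = 0 by rewrite /chord mulr0 sin0.
rewrite !(@chord_rec R Q 5, @chord_rec R Q 4, @chord_rec R Q 3, @chord_rec R Q 2,
  @chord_rec R Q 1, @chord_rec R Q 0) chord0 -/c.
by split; ring.
Qed.

(** No halving or trisection leads to 11. Instead [sin (5 pi / 11) = sin (6 pi / 11)] makes [c] a
    root of an explicit quintic, which has no root between 1.73 and 1.91. *)
Lemma cos_pi11_ge (R : realType) : 191 / 100 <= 2 * cos (pi / 11%:R) :> R.
Proof.
have chord56 : chord R 11 6 = chord R 11 5.
  by have := @chordDQ R 11 (- 5) isT; rewrite chordN opprK.
have [_ _ c5 c6 _] := chord_small R 11.
have chord1 : chord R 11 1 != 0 by rewrite gt_eqF // chord_gt0.
move: chord56; rewrite c5 c6 => /(mulfI chord1).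
have := cos_pi6_ge R; have := @cos_pi_div_mono R 6 11 isT.
set z := cos (_ / 6%:R); set y := cos (_ / 11%:R) => zy z1.
have : 173 / 100 <= 2 * y by lra.
move: (2 * y) => c c1 cE; rewrite leNgt; apply/negP => c2.
(* In the defect [t] from 1.91 the quintic is refuted by linear arithmetic once the powers of [t]
   are bounded against each other. *)
have [t tE] : exists t, c = 191 / 100 - t by exists (191 / 100 - c); ring.
have {c1 c2} [t0 t1] : 0 < t /\ t <= 18 / 100 by split; lra.
have t2 : t ^+ 2 <= 18 / 100 * t by nra.
have t3 : 0 <= t ^+ 3 by rewrite exprn_ge0 // ltW.
have t4 : t ^+ 4 <= 18 / 100 * t ^+ 3 by rewrite exprS ler_wpM2r.
have t5 : 0 <= t ^+ 5 by rewrite exprn_ge0 // ltW.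
by move: cE; rewrite tE => cE; lra.
Qed.

(** Replacing each ratio of chords by a rational bound leaves an inequality linear in [x^-1]. *)
Lemma inv_mul_le (R : realFieldType) (x s : R) (a b : nat) :
    0 < x -> (0 < a)%N -> (0 < b)%N -> a%:R / b%:R <= s ->
  (x * s)^-1 <= x^-1 * (b%:R / a%:R).
Proof.
move=> x0 a0 b0 Ls; have ab0 : 0 < a%:R / b%:R :> R by rewrite divr_gt0 ?ltr0n.
have s0 := lt_le_trans ab0 Ls.
by rewrite invfM ler_pM2l ?invr_gt0 // -[_ / a%:R]invf_div lef_pV2.
Qed.

Lemma inv_chord_anti (R : realType) (Q a b : nat) :
  (0 < a)%N -> (a <= b)%N -> (b <= Q./2)%N -> (chord R Q b)^-1 <= (chord R Q a)^-1.
Proof.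
move=> a0; rewrite leq_eqVlt => /orP[/eqP -> //|ab] bQ.
have bQ2 : (b.*2 <= Q)%N by lia.
rewrite lef_pV2 ?posrE ?chord_gt0 ?(ltW (chord_mono _ ab bQ2)) //; lia.
Qed.

Lemma cheb_345 (R : realFieldType) (c : R) : 191 / 100 <= c ->
  [/\ 2648%:R / 1000%:R <= c ^+ 2 - 1,
      3147%:R / 1000%:R <= c * (c ^+ 2 - 2) &
      3363%:R / 1000%:R <= c ^+ 2 * (c ^+ 2 - 3) + 1].
Proof.
move=> c_ge; have c2_ge : 3648 / 1000 <= c ^+ 2 by nra.
split; [lra|nra|nra].
Qed.

(** The bound 11 cannot be lowered: for [Q = 10] the left side is already the larger one. *)
Lemma inv_chord_345 (R : realType) (Q : nat) : (11 <= Q)%N ->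
  (chord R Q 3)^-1 + (chord R Q 4)^-1 + (chord R Q 5)^-1 <
    (chord R Q 1)^-1.
Proof.
move=> Qn; have c_ge : 191 / 100 <= 2 * cos (pi / Q%:R) :> R.
  by have := cos_pi11_ge R; have := @cos_pi_div_mono R 11 Q Qn; lra.
have x0 : 0 < chord R Q 1 by apply: chord_gt0; lia.
have [E3 E4 E5 _ _] := chord_small R Q.
rewrite E3 E4 E5.
have [b3 b4 b5] := cheb_345 c_ge.
have {}b3 := @inv_mul_le _ _ _ 2648 1000 x0 isT isT b3.
have {}b4 := @inv_mul_le _ _ _ 3147 1000 x0 isT isT b4.
have {}b5 := @inv_mul_le _ _ _ 3363 1000 x0 isT isT b5.
move: x0 b3 b4 b5; rewrite -invr_gt0.
set x := (chord R Q 1)^-1; clear c_ge E3 E4 E5; lra.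
Qed.

Lemma cheb_3457 (R : realFieldType) (c : R) : 19828 / 10000 <= c ->
  [/\ 293%:R / 100%:R <= c ^+ 2 - 1,
      382%:R / 100%:R <= c * (c ^+ 2 - 2),
      465%:R / 100%:R <= c ^+ 2 * (c ^+ 2 - 3) + 1 &
      60%:R / 10%:R <= c ^+ 2 * (c ^+ 2 - 2) * (c ^+ 2 - 3) - 1].
Proof.
move=> c_ge; have c2_ge : 393 / 100 <= c ^+ 2 by nra.
have c4_ge : 758 / 100 <= c ^+ 2 * (c ^+ 2 - 2) by nra.
split; [lra|nra|nra|nra].
Qed.

Lemma inv_chord_3457 (R : realType) (Q : nat) : (24 <= Q)%N ->
  (chord R Q 3)^-1 + (chord R Q 4)^-1 + (chord R Q 5)^-1 + (chord R Q 7)^-1 <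
    (chord R Q 1)^-1.
Proof.
move=> Qn; have c_ge : 19828 / 10000 <= 2 * cos (pi / Q%:R) :> R.
  by have := cos_pi24_ge R; have := @cos_pi_div_mono R 24 Q Qn; lra.
have x0 : 0 < chord R Q 1 by apply: chord_gt0; lia.
have [E3 E4 E5 _ E7] := chord_small R Q.
rewrite E3 E4 E5 E7.
have [b3 b4 b5 b7] := cheb_3457 c_ge.
have {}b3 := @inv_mul_le _ _ _ 293 100 x0 isT isT b3.
have {}b4 := @inv_mul_le _ _ _ 382 100 x0 isT isT b4.
have {}b5 := @inv_mul_le _ _ _ 465 100 x0 isT isT b5.
have {}b7 := @inv_mul_le _ _ _ 60 10 x0 isT isT b7.
move: x0 b3 b4 b5 b7; rewrite -invr_gt0.
set x := (chord R Q 1)^-1; clear c_ge E3 E4 E5 E7; lra.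
Qed.

Lemma cheb_3456 (R : realFieldType) (c : R) : 1986 / 1000 <= c ->
  [/\ 294%:R / 100%:R <= c ^+ 2 - 1,
      386%:R / 100%:R <= c * (c ^+ 2 - 2),
      472%:R / 100%:R <= c ^+ 2 * (c ^+ 2 - 3) + 1 &
      551%:R / 100%:R <= c * (c ^+ 2 - 1) * (c ^+ 2 - 3)].
Proof.
move=> c_ge; have c2_ge : 3944 / 1000 <= c ^+ 2 by nra.
have c3_ge : 5846 / 1000 <= c * (c ^+ 2 - 1) by nra.
split; [lra|nra|nra|nra].
Qed.

Lemma inv_chord_3456 (R : realType) (Q : nat) : (27 <= Q)%N ->
  (chord R Q 3)^-1 + (chord R Q 4)^-1 + (chord R Q 5)^-1 + (chord R Q 6)^-1 <
    (chord R Q 1)^-1.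
Proof.
move=> Qn; have c_ge : 1986 / 1000 <= 2 * cos (pi / Q%:R) :> R.
  by have := cos_pi27_ge R; have := @cos_pi_div_mono R 27 Q Qn; lra.
have x0 : 0 < chord R Q 1 by apply: chord_gt0; lia.
have [E3 E4 E5 E6 _] := chord_small R Q.
rewrite E3 E4 E5 E6.
have [b3 b4 b5 b6] := cheb_3456 c_ge.
have {}b3 := @inv_mul_le _ _ _ 294 100 x0 isT isT b3.
have {}b4 := @inv_mul_le _ _ _ 386 100 x0 isT isT b4.
have {}b5 := @inv_mul_le _ _ _ 472 100 x0 isT isT b5.
have {}b6 := @inv_mul_le _ _ _ 551 100 x0 isT isT b6.
move: x0 b3 b4 b5 b6; rewrite -invr_gt0.
set x := (chord R Q 1)^-1; clear c_ge E3 E4 E5 E6; lra.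
Qed.

(** Without 2 all entries are at least 3, and even the smallest admissible ones give too small a
    sum. *)
Lemma two_mem (R : realType) (Q : nat) (s : seq nat) :
    uniq s -> all (fun a => [&& 2 <= a, a <= Q./2 & coprime a Q])%N s ->
    (size s <= 3)%N || (size s == 4) && (24 <= Q)%N -> (2 <= Q)%N ->
    (chord R Q 1)^-1 <= \sum_(a <- s) (chord R Q a)^-1 ->
  2%N \in s.
Proof.
move=> su sall ssize Q2 sum_ge; apply: contraT => s2.
have {s2}sall a : a \in s -> [/\ (3 <= a)%N, (a <= Q./2)%N & coprime a Q].
  move=> sa; have /and3P[a2 aQ acop] := allP sall a sa; split=> //.
  by rewrite ltn_neqAle a2 andbT; apply: contraNneq s2 => ->.
have inv_ge0 a : (a <= Q./2)%N -> 0 <= (chord R Q a)^-1.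
  case: a => [|a] aQ; first by rewrite /chord mulr0 sin0 invr0.
  by rewrite invr_ge0 ltW // chord_gt0 //; lia.
have s_range : all (fun a => 3 <= a <= Q./2)%N s.
  by apply/allP => a /sall[-> ->].
have anti a b : (3 <= a)%N -> (a <= b)%N -> (b <= Q./2)%N ->
    (chord R Q b)^-1 <= (chord R Q a)^-1.
  by move=> a3 ab bQ; apply: inv_chord_anti => //; lia.
have bound := @sum_antitone R (fun a => (chord R Q a)^-1) 3 Q./2.
have bound3 t : uniq t -> all (fun a => 3 <= a <= Q./2)%N t -> (size t <= 3)%N ->
    (11 <= Q)%N ->
    \sum_(a <- t) (chord R Q a)^-1 <=
      (chord R Q 3)^-1 + (chord R Q 4)^-1 + (chord R Q 5)^-1.
  move=> tu tr t3 Q11; apply: le_trans (bound t anti tu tr) _.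
  have Q5 : (5 <= Q./2)%N by apply: (half_leq Q11).
  have g3 := inv_ge0 3%N (ltnW (ltnW Q5)); have g4 := inv_ge0 4%N (ltnW Q5).
  have g5 := inv_ge0 5%N Q5; clear sall s_range anti bound tr.
  case: (size t) t3 => [|[|[|[|//]]]] _;
    rewrite ?big_ord_recr big_ord0 /=; lra.
have [ssize3|] := leqP (size s) 3.
  have [Q11|Q11] := leqP 11 Q.
    by have := inv_chord_345 R Q11; have := bound3 s su s_range ssize3 Q11; lra.
  (* For [Q <= 10] at most one of 3, 4, 5 is at most [Q / 2] and coprime to [Q]; a single entry from
     3 on has an inverse chord below that of 1. *)
  have : (size s <= 1)%N.
    have /uniq_leq_size -/(_ su) /leq_trans : {subset s <=
        [seq a <- iota 3 3 | (a <= Q./2)%N && coprime a Q]}.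
      move=> a /sall[a3 aQ acop]; rewrite mem_filter mem_iota aQ acop /=; lia.
    apply; clear -Q11 Q2; move: Q11 Q2.
    by do 11 (case: Q => [//|Q]).
  case: s su sall s_range sum_ge {ssize ssize3} => [|a [|//]] _ sall _ sum_ge _.
    move: sum_ge; rewrite big_nil leNgt invr_gt0 chord_gt0 //; lia.
  have [//|a3 aQ _] := sall a; first exact: mem_head.
  move: sum_ge; rewrite big_seq1 lef_pV2 ?posrE ?chord_gt0 //; try lia.
  by rewrite leNgt chord_mono //; lia.
move=> ssize4; move: ssize; rewrite leqNgt ssize4 /= => /andP[/eqP ss Q24].
(* Either some entry is at least 7, and 3, 4, 5, 7 is the worst case, or the entries are exactly 3,
   4, 5, 6. *)
have [/hasP[a sa a7]|/hasPn small] := boolP (has (fun a => 7 <= a)%N s).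
  have [_ aQ _] := sall a sa.
  have rem_range : all (fun a => 3 <= a <= Q./2)%N (rem a s).
    by apply/allP => b /mem_rem; apply: (allP s_range).
  have := bound3 (rem a s) (rem_uniq _ su) rem_range.
  rewrite size_rem // ss => /(_ isT (leq_trans (isT : 11 <= 24)%N Q24)).
  have := @inv_chord_anti R Q 7 a isT a7 aQ; have := inv_chord_3457 R Q24.
  move: sum_ge; rewrite (perm_big _ (perm_to_rem sa)) big_cons /=.
  by clear; lra.
have mem3456 : s =i iota 3 4.
  have sub a : a \in s -> a \in iota 3 4.
    move=> sa; rewrite mem_iota; have := small a sa; have [a3 _ _] := sall a sa.
    by rewrite -ltnNge a3.
  by have [] := uniq_min_size su sub; rewrite ?ss.
(* [Q] is coprime to 5 and to 6, which excludes 24, 25 and 26. *)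
have Q27 : (27 <= Q)%N.
  have [_ _ c5] : [/\ (3 <= 5)%N, (5 <= Q./2)%N & coprime 5 Q].
    by apply: sall; rewrite mem3456.
  have [_ _ c6] : [/\ (3 <= 6)%N, (6 <= Q./2)%N & coprime 6 Q].
    by apply: sall; rewrite mem3456.
  rewrite leqNgt; apply/negP => Q27; move: c5 c6.
  have : Q \in iota 24 3 by rewrite mem_iota Q24.
  by rewrite !inE => /or3P[] /eqP ->.
have := inv_chord_3456 R Q27; move: sum_ge.
have s3456 : perm_eq s (iota 3 4) by apply: uniq_perm.
rewrite (perm_big _ s3456) /=; clear.
by rewrite !big_cons big_nil /=; lra.
Qed.

(** * The Fourier relation in terms of chords *)

(* [N k] stands for the ratio [p k0 / p k]. *)
Lemma beatty_chord_sum (R : realType) (q Q g m c : nat) (p : 'I_m -> nat)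
    (r N : 'I_m -> int) (k0 : 'I_m) :
    (1 < Q)%N -> (0 < g)%N -> q = (g * Q)%N ->
    (forall k, 0 < p k < q)%N ->
    (forall k, period q (p k) <= Q)%N -> period q (p k0) = Q ->
    (forall k, period q (p k) = Q ->
       ((p k)%:Z * N k = (p k0)%:Z %[mod q%:Z])%Z) ->
    perfect_fold_covering c (fun k => beatty (p k) q (r k)) ->
  \sum_(k | period q (p k) == Q)
     eta R Q ^ (2 * (p k0 %/ g)%N%:Z * r k + N k) * ((chord R Q (N k))^-1)%:C%C = 0.
Proof.
move=> Q1 g0 qE p_range Qmax k0K NP cov.
have q0 : (0 < q)%N by rewrite qE muln_gt0 g0; lia.
have gcdE k : period q (p k) = Q -> gcdn (p k) q = g.
  move=> kK; have := divnK (dvdn_gcdr (p k) q).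
  rewrite -/(period q (p k)) kK {2}qE mulnC => /eqP.
  by rewrite eqn_pmul2r; [move/eqP|lia].
have cop k : period q (p k) = Q -> (g %| p k)%N /\ coprime (p k %/ g) Q.
  move=> kK; have gE := gcdE k kK; have gp : (g %| p k)%N by rewrite -gE dvdn_gcdl.
  split=> //; rewrite /coprime -(eqn_pmul2l g0) muln_gcdr muln1 -qE.
  by rewrite mulnC divnK // gE.
set p' := (p k0 %/ g)%N; have [gp0 p'cop] := cop k0 k0K.
have p'E : (p k0)%:Z = p'%:Z * g%:Z by rewrite -PoszM divnK.
have [v vP] : exists v : 'I_m -> int, forall k, period q (p k) = Q ->
    ((p k)%:Z * v k = g%:Z %[mod q%:Z])%Z.
  have vk k : exists v, period q (p k) = Q -> ((p k)%:Z * v = g%:Z %[mod q%:Z])%Z.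
    have [u [v uv]] := Bezoutz (p k) q; exists u => kK.
    apply/eqz_modP; exists (- v); rewrite -(gcdE k kK) -[(gcdn _ _)%:Z]uv; ring.
  by exists (fun k => sval (cid (vk k))) => k; case: cid.
(* Among the primitive roots this choice turns the exponent [v k] into [N k]; the ratio attached to
   [k0] becomes 1 modulo [Q]. *)
have wP : Q.-primitive_root (eta R Q ^+ (2 * p')).
  have := exp_prim_root (eta_prim R (ltnW Q1)) (2 * p').
  by rewrite -mul2n -muln_gcdr (eqP p'cop) muln1 mulKn.
have := beatty_fourier wP Q1 g0 qE p_range Qmax vP cov.
have i2 : 2 * 'i%C != 0 :> R[i].
  by rewrite mulf_neq0 ?pnatr_eq0 // eq_complex /= oner_eq0 andbF.
move=> /(congr1 ( *%R (2 * 'i%C))); rewrite mulr0 mulr_sumr => sum0.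
rewrite -[RHS]sum0; apply: eq_bigr => k /eqP kK.
have eta0 : eta R Q != 0 := cis_neq0 _.
have etaE z : (eta R Q ^+ (2 * p')) ^ z = eta R Q ^ (2 * p'%:Z * z).
  by rewrite -exprz_exp exprnP PoszM.
have [n NE] : exists n, N k = p'%:Z * v k + n * Q%:Z.
  have /eqz_modP[t tE] := NP k kK; have /eqz_modP[t' t'E] := vP k kK.
  have [gpk pkcop] := cop k kK.
  have : (Q%:Z %| (p k %/ g)%N%:Z * (N k - p'%:Z * v k))%Z.
    apply/dvdzP; exists (t - p'%:Z * t'); apply: (@mulfI _ g%:Z); first by lia.
    have pkE : (p k)%:Z = g%:Z * (p k %/ g)%N%:Z by rewrite -PoszM mulnC divnK.
    rewrite mulrA -pkE; transitivity ((p k)%:Z * N k - p'%:Z * ((p k)%:Z * v k)).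
      by ring.
    by rewrite tE t'E p'E qE PoszM; ring.
  rewrite Gauss_dvdzr; last by rewrite /coprimez /gcdz /= gcdnC; exact: pkcop.
  by move=> /dvdzP[n nE]; exists n; rewrite -nE; ring.
(* Both factors change sign when [z] grows by [Q], so the term depends only on [z] modulo [Q], and
   [N k] may replace [p' * v k]. *)
have termE z j : eta R Q ^ (z + j * Q%:Z) * ((chord R Q (z + j * Q%:Z))^-1)%:C%C =
    eta R Q ^ z * ((chord R Q z)^-1)%:C%C.
  have step y : eta R Q ^ (y + Q%:Z) * ((chord R Q (y + Q%:Z))^-1)%:C%C =
      eta R Q ^ y * ((chord R Q y)^-1)%:C%C.
    rewrite expfzDr // -[_ ^ Q%:Z]/(_ ^+ Q) eta_order ?(ltnW Q1) //.
    by rewrite chordDQ ?(ltnW Q1) // invrN rmorphN /= mulrN1 mulrNN.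
  have stepn y n' : eta R Q ^ (y + n'%:Z * Q%:Z) *
      ((chord R Q (y + n'%:Z * Q%:Z))^-1)%:C%C =
      eta R Q ^ y * ((chord R Q y)^-1)%:C%C.
    elim: n' => [|n' IHn]; first by rewrite mul0r addr0.
    have -> : y + n'.+1%:Z * Q%:Z = y + n'%:Z * Q%:Z + Q%:Z.
      by rewrite -addn1 PoszD; ring.
    by rewrite step.
  case: j => j; first exact: stepn.
  rewrite -(stepn _ j.+1) NegzE.
  by have -> : z + - j.+1%:Z * Q%:Z + j.+1%:Z * Q%:Z = z by ring.
set M := p'%:Z * v k in NE.
transitivity (eta R Q ^ (2 * p'%:Z * r k) *
    (eta R Q ^ M * ((chord R Q M)^-1)%:C%C)).
  by rewrite -(termE M n) -NE expfzDr // mulrA.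
rewrite !etaE.
have -> : 2 * p'%:Z * (r k + v k) = 2 * p'%:Z * r k + M + M by rewrite /M; ring.
have -> : 2 * p'%:Z * v k = M + M by rewrite /M; ring.
have etaM : eta R Q ^ M != 0 by rewrite expfz_neq0.
have -> : eta R Q ^ (M + M) - 1 =
    eta R Q ^ M * (2 * 'i%C * (chord R Q M)%:C%C).
  rewrite expfzDr // /chord -cisB -cis_exprz mulrBr divff //.
rewrite !expfzDr // fmorphV /= !invfM.
set e1 := eta R Q ^ _; set e2 := eta R Q ^ M; set ch := (_%:C%C)^-1.
have -> : 2 * 'i%C * (e1 * e2 * e2 * (e2^-1 * (2^-1 * ('i%C)^-1 * ch))) =
  (2 * 'i%C * (2 * 'i%C)^-1) * (e2 * e2^-1) * (e1 * (e2 * ch)) :> R[i].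
  by rewrite invfM; ring.
by rewrite !divff // !mul1r.
Qed.

(** * Five sets and a small modulus *)

(** [v] records how often each point is still to be covered and [n] how many sets remain after the
    current one. A point that is covered too often, or that needs more than [n] further sets, ends
    the branch. *)
Fixpoint place (n : nat) (v : seq nat) (d : seq bool) : option (seq nat) :=
  match v, d with
  | x :: v', b :: d' =>
      match x, b with
      | 0, true => None
      | x'.+1, true =>
        if Nat.leb x' n then
          if place n v' d' is Some u then Some (x' :: u) else None
        else None
      | _, false =>
        if Nat.leb x n then
          if place n v' d' is Some u then Some (x :: u) else None
        else None
      end
  | _, _ => Some [::]
  end.

(** The empty list yields [false]: the last call of [place] had [n = 0], so all demands are 0 and a
    covering has been found. *)
Fixpoint no_cover (q : nat) (v : seq nat) (ds : seq (seq bool)) : bool :=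
  if ds is d :: ds' then
    all (fun n => if place (size ds') v (drop n d) is Some u
                  then no_cover q u ds' else true) (iota 0 q)
  else false.

Fixpoint sublists (k : nat) (s : seq nat) : seq (seq nat) :=
  match k, s with
  | 0, _ => [:: [::]]
  | k'.+1, x :: s' => map (cons x) (sublists k' s') ++ sublists k s'
  | _, [::] => [::]
  end.

(** Two periods are listed so that [drop n] gives a translate on a full period; subtracting from
    [q.*2] avoids truncation in [nat]. *)
Definition beatty_row (q w : nat) : seq bool :=
  mkseq (fun y => (w * (q.*2 - y)) %% q < w)%N q.*2.

(** A normalized search: the fifth weight is 1 and its set is the class of 0, whence the successor
    of the sum and the term [y == 0]. The total weight is [q] times the multiplicity, so totals not
    divisible by [q] are skipped, as are opposite pairs. *)
Definition no_five_cover (q : nat) : bool :=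
  all (fun ws =>
     if has (fun w => (q - w)%N \in ws) ws || ~~ (q %| (sumn ws).+1)%N then true
     else no_cover q (mkseq (fun y => ((sumn ws).+1 %/ q - (y == 0))%N) q)
            (map (beatty_row q) ws))
   (sublists 4 [seq w <- iota 2 (q - 3) | coprime w q]).

Lemma no_five_cover_small : all no_five_cover (iota 3 21).
Proof. by vm_cast_no_check (erefl true). Qed.

Lemma leb_leq (m n : nat) : Nat.leb m n = (m <= n)%N.
Proof. by elim: m n => [|m IHm] [|n] //=; rewrite IHm. Qed.

Lemma placeP (n : nat) (v : seq nat) (d : seq bool) :
    (size v <= size d)%N ->
    (forall y, (y < size v)%N ->
      (nth false d y <= nth 0 v y <= n + nth false d y)%N) ->
  exists2 u, place n v d = Some u & size u = size v /\
    (forall y, (y < size v)%N -> nth 0 u y = nth 0 v y - nth false d y)%N.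
Proof.
elim: v d => [|x v IHv] [|b d] //=; [by exists [::]|by exists [::]|].
move=> vd vP; have [|u -> [uv uP]] := IHv d vd.
  by move=> y yv; apply: (vP y.+1).
have := vP 0%N isT; case: b vP => /= vP; case: x vP => [|x] vP //=.
- rewrite addn1 ltnS => xn; rewrite leb_leq xn.
  by exists (x :: u) => //=; rewrite uv; split=> // -[|y] yv /=; rewrite ?subn1 ?uP.
- by move=> _; exists (0%N :: u); rewrite //= uv; split=> // -[|y] yv /=; rewrite ?subn0 ?uP.
- rewrite addn0 => xn; have -> : (match n with 0 => false | n'.+1 => Nat.leb x n' end) = true.
    by case: (n) xn => // n'; rewrite leb_leq.
  by exists (x.+1 :: u); rewrite //= uv; split=> // -[|y] yv /=; rewrite ?subn0 ?uP.
Qed.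

(** Soundness of the search: the true offsets [ns] survive the pruning, since the demand left after
    each set is met by the later sets and so is at most their number. *)
Lemma no_coverP (q : nat) (v : seq nat) (ds : seq (seq bool)) (ns : seq nat) :
    size v = q -> size ns = size ds -> all (fun n => n < q)%N ns ->
    all (fun d => size d == q.*2) ds ->
    (forall y, (y < q)%N ->
       nth 0 v y = \sum_(nd <- zip ns ds) nth false nd.2 (nd.1 + y))%N ->
  no_cover q v ds = false.
Proof.
elim: ds ns v => [|d ds IHds] [|n ns] // v vq /= [nds] /andP[nq nsq].
move=> /andP[/eqP dq dsq] vP; apply/negbTE/allPn; exists n; first by rewrite mem_iota.
have sum_le y : (\sum_(nd <- zip ns ds) nth false nd.2 (nd.1 + y) <= size ds)%N.
  rewrite -nds -(size1_zip (_ : size ns <= size ds)%N) ?nds //.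
  by rewrite -sum1_size leq_sum // => nd _; case: nth.
have [||u -> [uq uP]] := @placeP (size ds) v (drop n d).
- by rewrite size_drop dq vq; lia.
- move=> y yv; rewrite vP ?vq // -?vq // big_cons /= nth_drop.
  by rewrite leq_addr addnC leq_add2r sum_le.
rewrite (IHds ns) //; first by rewrite uq.
move=> y yq; rewrite uP ?vq // vP // big_cons /= nth_drop addKn; done.
Qed.

Lemma mem_sublists (k : nat) (s t : seq nat) :
  subseq t s -> size t = k -> t \in sublists k s.
Proof.
move=> + <-; elim: s t => [|x s IHs] [|y t] //= ts.
rewrite mem_cat; case: eqP ts => [->|_] ts.
  by apply/orP; left; rewrite mem_map; [exact: IHs | move=> ? ? []].
by rewrite (IHs (y :: t)) ?orbT.
Qed.

(** Moving by [t] lowers the residue by [w], with a wrap exactly when it was below [w]. For [t = 1]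
    and [w = p] the wrap is membership of [x], which ties coverings to sums of residues. *)
Lemma beatty_residD (p q w : nat) (r x t : int) :
    (0 < p < q)%N -> (w < q)%N -> (p%:Z * t = w%:Z %[mod q%:Z])%Z ->
  beatty_resid p q r (x + t) =
    beatty_resid p q r x - w%:Z + q%:Z * (beatty_resid p q r x < w%:Z)%R%:Z.
Proof.
move=> pq wq /eqz_modP[s sE]; have := @modz_bound q (p%:Z * (r - x)).
have := divz_eq (p%:Z * (r - x)) q%:Z; rewrite {2}/beatty_resid -/(beatty_resid p q r x).
set u := (_ %/ _)%Z; rewrite -/(beatty_resid p q r x).
move: (beatty_resid p q r x) => y yE yq.
have {}yq : 0 <= y < q%:Z by apply: yq; lia.
have E : p%:Z * (r - (x + t)) = y - w%:Z + (u - s) * q%:Z.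
  by transitivity (p%:Z * (r - x) - p%:Z * t); [ring|rewrite sE yE; ring].
have [yw|yw] := ltP y w%:Z; rewrite /beatty_resid.
  apply: (@modz_eqP _ _ _ (u - s - 1)); first by lia.
  by rewrite E /=; ring.
apply: (@modz_eqP _ _ _ (u - s)); first by lia.
by rewrite E /=; ring.
Qed.

(** By the covering, unit steps change the sum [F] of residues by a constant [D], and periodicity
    modulo [q] makes [D] zero. A step of length [t] then leaves [F] unchanged too, and its wraps
    count membership in the dilated sets. *)
Lemma cover_dilate (q m c : nat) (p w : 'I_m -> nat) (r : 'I_m -> int) (t tb : nat) :
    (forall k, 0 < p k < q)%N -> (t * tb = 1 %[mod q])%N ->
    (forall k, w k = (p k * t) %% q)%N ->
    (forall x, \sum_k (beatty_resid (p k) q (r k) x < (p k)%:Z)%R = c)%N ->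
  (forall y, \sum_k w k =
     (\sum_k (beatty_resid (w k) q (tb%:Z * r k) y < (w k)%:Z)%R) * q)%N.
Proof.
move=> p_range ttb wE cov y.
have [k0 _|noI] := pickP (fun _ : 'I_m => true); last first.
  by rewrite !big1 // => k; have := noI k.
have q0 : (0 < q)%N by have := p_range k0; lia.
pose F x : int := \sum_k beatty_resid (p k) q (r k) x.
have step1 x : F (x + 1) = F x + (q%:Z * c%:Z - \sum_k (p k)%:Z).
  rewrite /F -(cov x) -[X in q%:Z * X]natz natr_sum mulr_sumr -sumrB -big_split /=.
  apply: eq_bigr => k _; rewrite (@beatty_residD _ _ (p k)) //; last 2 first.
  - by have := p_range k; lia.
  - by rewrite mulr1.
  by rewrite /= natz; ring.
set D := _ - _ in step1.
have Fn x n : F (x + n%:Z) = F x + D * n%:Z.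
  elim: n => [|n IHn]; first by rewrite mulr0 !addr0.
  by rewrite -addn1 PoszD addrA step1 IHn; ring.
have D0 : D = 0.
  have := Fn 0 q; rewrite /F.
  under eq_bigr => k _ do rewrite beatty_resid_period ?dvdz_mull //.
  move/eqP; rewrite -subr_eq0 opprD addrA subrr add0r oppr_eq0 mulf_eq0.
  by rewrite [q%:Z == 0]gt_eqF ?orbF // => /eqP.
have Ft : F (t%:Z * y + t%:Z) = F (t%:Z * y) by rewrite Fn D0 mul0r addr0.
have residE k : beatty_resid (w k) q (tb%:Z * r k) y =
    beatty_resid (p k) q (r k) (t%:Z * y).
  have [s sE] : exists s, (w k)%:Z = (p k)%:Z * t%:Z + s * q%:Z.
    exists (- ((p k * t) %/ q)%N%:Z); rewrite wE -PoszM {2}(divn_eq (p k * t) q).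
    by rewrite PoszD PoszM; ring.
  have [s' s'E] : exists s, t%:Z * tb%:Z = 1 + s * q%:Z.
    apply/eqz_modP; rewrite -PoszM !modz_nat ttb; done.
  apply/eqz_modP; rewrite sE.
  exists (s * (tb%:Z * r k - y) + (p k)%:Z * s' * r k).
  transitivity ((p k)%:Z * ((t%:Z * tb%:Z) * r k - t%:Z * y) +
    s * (tb%:Z * r k - y) * q%:Z); first by ring.
  by rewrite s'E; ring.
set S := (X in (X * q)%N).
have SE : S = (\sum_k (beatty_resid (p k) q (r k) (t%:Z * y) < (w k)%:Z)%R)%N.
  by apply: eq_bigr => k _; rewrite residE.
apply/eqP; rewrite -eqz_nat PoszM; apply/eqP.
have : F (t%:Z * y + t%:Z) = F (t%:Z * y) - (\sum_k (w k)%:Z) + S%:Z * q%:Z.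
  rewrite /F SE -!natz !natr_sum mulr_suml -sumrB -big_split /=.
  apply: eq_bigr => k _; rewrite (@beatty_residD _ _ (w k)) //.
  - by rewrite !natz; ring.
  - by rewrite wE ltn_mod.
  - by rewrite natz -PoszM !modz_nat wE modn_mod.
have <- : \sum_k (w k)%:Z = (\sum_k w k)%N%:Z.
  by rewrite -[RHS]natz natr_sum; apply: eq_bigr => k _; rewrite natz.
by rewrite Ft; lia.
Qed.

Lemma no_small_five_cover (q m c : nat) (p : 'I_m -> nat) (r : 'I_m -> int) :
    m = 5 -> (3 <= q < 24)%N -> injective p -> (forall k, 0 < p k < q)%N ->
    (forall k, coprime (p k) q) -> (forall k l, p k + p l <> q)%N ->
    (forall x, \sum_k (beatty_resid (p k) q (r k) x < (p k)%:Z)%R = c)%N ->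
  False.
Proof.
move=> m5; subst m => q_range p_inj p_range p_cop p_opp cov.
have q0 : (0 < q)%N by lia.
(* Dilating by the inverse of [p ord0] makes one of the sets a single class mod q. *)
have [t tP] : exists t, (t * p ord0 = 1 %[mod q])%N.
  have p0 : (0 < p ord0)%N by have /andP[] := p_range ord0.
  case: (egcdnP q p0) => t n tE _; exists t.
  by rewrite tE (eqP (p_cop ord0)) modnMDl.
pose w k := (p k * t %% q)%N.
have := cover_dilate p_range tP (fun k => erefl : w k = _) cov.
(* A translation makes [S ord0] zero, so that the set of weight 1 becomes the class of 0. *)
pose S k : int := (p ord0)%:Z * r k - (p ord0)%:Z * r ord0.
move=> cov1; have {cov1} cov2 y :
    (\sum_k w k = (\sum_k (beatty_resid (w k) q (S k) y < (w k)%:Z)%R) * q)%N.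
  rewrite (cov1 (y + (p ord0)%:Z * r ord0)); congr (_ * _)%N; apply: eq_bigr => k _.
  by rewrite /beatty_resid /S; congr (nat_of_bool ((_ * _ %% _)%Z < _)%R); ring.
have w0 : w ord0 = 1%N by rewrite /w mulnC tP modn_small //; lia.
have wP k : (p k = w k * p ord0 %[mod q])%N.
  by rewrite /w modnMml -mulnA -modnMmr tP modnMmr muln1.
have w_lt k : (w k < q)%N by rewrite ltn_mod.
have w_inj : injective w.
  move=> k l wkl; apply: p_inj; have := wP k; rewrite wkl -wP !modn_small //.
    by have /andP[] := p_range l.
  by have /andP[] := p_range k.
have w_cop k : coprime (w k) q.
  have : coprime (w k * p ord0) q by rewrite -coprime_modl -wP coprime_modl.
  by rewrite coprimeMl => /andP[].
have w_opp k l : (w k + w l)%N != q.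
  apply/eqP => wkl; apply: (p_opp k l).
  have : (q %| p k + p l)%N.
    rewrite /dvdn -modnDm !wP modnDm -mulnDl wkl modnMr; done.
  have := p_range k; have := p_range l => pl pk.
  by case/dvdnP=> -[|[|n]]; rewrite ?mulSn; lia.
pose W := [seq w (lift ord0 i) | i <- enum 'I_4].
pose U := [seq u <- iota 2 (q - 3) | coprime u q].
pose ws := [seq u <- U | u \in W].
have W_uniq : uniq W.
  by rewrite map_inj_uniq ?enum_uniq // => i j /w_inj/lift_inj.
have wsW : perm_eq ws W.
  apply: uniq_perm => //; first by rewrite !filter_uniq ?iota_uniq.
  move=> u; rewrite !mem_filter; apply/andP/idP => [[//]|uW]; split=> //.
  have /mapP[i _ uE] := uW; rewrite uE w_cop mem_iota /=.
  set k := lift ord0 i; have := w_opp k ord0; rewrite w0.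
  have k1 : w k != 1%N by rewrite -w0 (inj_eq w_inj) eq_sym neq_lift.
  have k0 : w k != 0%N.
    by apply: contraTneq (w_cop k) => ->; rewrite /coprime gcd0n; lia.
  by have := w_lt k; lia.
have ws_size : size ws = 4 by rewrite (perm_size wsW) size_map size_enum_ord.
have sumW : (sumn ws).+1 = (\sum_k w k)%N.
  by rewrite [RHS]big_ord_recl w0 (perm_sumn wsW) sumnE big_map big_enum.
have ws_mem : ws \in sublists 4 U by rewrite mem_sublists ?filter_subseq.
have : no_five_cover q.
  by apply: (allP no_five_cover_small); rewrite mem_iota; lia.
move=> /allP/(_ ws ws_mem); case: ifP => [/orP[]|_].
- case/hasP => u; rewrite (perm_mem wsW) => /mapP[i _ uE].
  rewrite (perm_mem wsW) => /mapP[j _ jE] _.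
  have /negP := w_opp (lift ord0 i) (lift ord0 j); apply.
  by rewrite -uE -jE subnKC // uE ltnW.
- by rewrite sumW (cov2 0) dvdn_mull.
(* Rows are indexed by weight, which determines [k] because [w] is injective; the default 0 is never
   met on [ws]. A row starts at offset 0, so the shift [S k] amounts to dropping [- S k] modulo [q]
   entries. *)
pose off u := if [pick k | w k == u] is Some k then `|((- S k) %% q%:Z)%Z|%N else 0%N.
have offE k : off (w k) = `|((- S k) %% q%:Z)%Z|%N.
  rewrite /off; case: pickP => [l /eqP/w_inj -> //|/(_ k)]; by rewrite eqxx.
have off_lt u : (off u < q)%N.
  rewrite /off; case: pickP => // k _; have := @modz_bound q (- S k) q0; lia.
rewrite (@no_coverP q _ _ (map off ws)) //.
- by rewrite size_mkseq.
- by rewrite !size_map.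
- by apply/allP => n /mapP[u _ ->].
- by apply/allP => d /mapP[u _ ->]; rewrite size_mkseq.
move=> y yq; rewrite nth_mkseq // sumW (cov2 y%:Z) mulnK //.
rewrite zip_map big_map (perm_big _ wsW) big_map big_enum /= big_ord_recl.
have -> : (beatty_resid (w ord0) q (S ord0) y%:Z < (w ord0)%:Z) = (y == 0%N).
  rewrite w0 /beatty_resid /S subrr sub0r mul1r.
  have [->|y0] := eqVneq y 0%N; first by rewrite oppr0 mod0z.
  by rewrite (@modz_eqP q _ (q%:Z - y%:Z) (-1)); [lia|lia|ring].
rewrite addKn; apply: eq_bigr => i _; set k := lift ord0 i; rewrite offE.
have offk := @modz_bound q (- S k) q0; have := divz_eq (- S k) q%:Z.
set u := (_ %/ _)%Z; set o := (_ %% _)%Z in offk *; move=> oE.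
rewrite nth_mkseq; last by lia.
congr nat_of_bool; rewrite -ltz_nat; congr (_ < _).
rewrite /beatty_resid -modz_nat; apply/eqz_modP.
exists ((w k)%:Z * (- u - 2)).
have -> : (w k * (q.*2 - (`|o| + y)))%N%:Z = (w k)%:Z * (q%:Z * 2 - (o + y%:Z)).
  by rewrite PoszM; congr (_ * _); lia.
by have -> : S k = - (u * q%:Z + o) by [rewrite -oE opprK]; ring.
Qed.

(** * Sums of inverse chords over powers of two *)

(* [1 / sin (2 a) = cot a - cot (2 a)] *)
Lemma inv_sin_double (R : realType) (a : R) : sin a != 0 -> sin (a *+ 2) != 0 ->
  (sin (a *+ 2))^-1 = cos a / sin a - cos (a *+ 2) / sin (a *+ 2).
Proof.
rewrite sin_mulr2n cos_mulr2n -mulr_natr => sa s2a.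
have ca : cos a != 0.
  by apply: contraNneq s2a => ->; rewrite mul0r mul0r.
have E : cos a ^+ 2 = 1 - sin a ^+ 2 by rewrite cos2sin2.
by apply: (mulIf s2a); field : E; rewrite ?sa ?ca.
Qed.

Lemma inv_chord_pow_sum (R : realType) (Q n : nat) : (2 ^ n < Q)%N ->
  \sum_(i < n) (chord R Q (2 ^ i.+1)%N)^-1 =
    cos (pi / Q%:R) / sin (pi / Q%:R) -
    cos (pi / Q%:R * (2 ^ n)%:R) / sin (pi / Q%:R * (2 ^ n)%:R).
Proof.
elim: n => [|n IHn] nQ; first by rewrite big_ord0 mulr1 subrr.
have nQ' : (2 ^ n < Q)%N by apply: leq_ltn_trans nQ; rewrite leq_pexp2l.
rewrite big_ord_recr /= IHn // /chord.
have E : pi / Q%:R * (2 ^ n.+1)%:R = pi / Q%:R * (2 ^ n)%:R *+ 2 :> R.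
  by rewrite expnS mulnC natrM mulrA mulr_natr.
have s1 : sin (pi / Q%:R * (2 ^ n)%:R) != 0 :> R.
  by have /gt_eqF/negbT := @chord_gt0 R Q (2 ^ n) ltac:(rewrite nQ' expn_gt0 //).
have s2 : sin (pi / Q%:R * (2 ^ n.+1)%:R) != 0 :> R.
  by have /gt_eqF/negbT := @chord_gt0 R Q (2 ^ n.+1) ltac:(rewrite nQ expn_gt0 //).
rewrite -pmulrn; rewrite E in s2 *.
by rewrite [X in _ + X = _](inv_sin_double s1 s2); ring.
Qed.

(** With [x = pi / Q], the last angle of the telescoping sum is [pi / 2 + x / 2], of cotangent
    [- tan (x / 2)], and [cot x + tan (x / 2) = 1 / sin x]. *)
Lemma inv_chord_mersenne (R : realType) (Q n : nat) : (1 < Q)%N ->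
    (2 ^ n.+1 = Q.+1)%N ->
  \sum_(i < n) (chord R Q (2 ^ i.+1)%N)^-1 = (chord R Q 1)^-1.
Proof.
move=> Q1 nQ; rewrite inv_chord_pow_sum; last by move: nQ; rewrite expnS; lia.
have Q0 : Q%:R != 0 :> R by rewrite pnatr_eq0; lia.
rewrite {1}/chord mulr1; set x := pi / Q%:R.
have -> : x * (2 ^ n)%:R = x / 2 + pi / 2.
  apply: (mulIf (_ : 2 != 0)); first by rewrite pnatr_eq0.
  rewrite -mulrA -(natrM _ _ 2) mulnC -expnS nQ /x.
  by rewrite -[Q.+1%:R]natr1; field.
rewrite cosDpihalf sinDpihalf mulNr opprK.
have x2 : x = (x / 2) *+ 2 by rewrite -mulr_natr divfK ?pnatr_eq0.
have sx0 : sin x != 0.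
  by have /gt_eqF/negbT := @chord_gt0 R Q 1 Q1; rewrite /chord mulr1.
move: (x / 2) x2 sx0 => y ->; rewrite sin_mulr2n cos_mulr2n => sy.
have cy : cos y != 0 by apply: contraNneq sy => ->; rewrite mul0r mul0rn.
have sy' : sin y != 0 by apply: contraNneq sy => ->; rewrite mulr0 mul0rn.
have E : cos y ^+ 2 = 1 - sin y ^+ 2 by rewrite cos2sin2.
by apply: (mulIf sy); field : E; rewrite ?sy' ?cy.
Qed.

(** Here the last angle is [pi / 2 - x / 2], so a positive [tan (x / 2)] is subtracted from [cot x],
    which is at most [1 / sin x]. *)
Lemma inv_chord_fermat (R : realType) (Q n : nat) : (1 < Q)%N ->
    (2 ^ n.+1 + 1 = Q)%N ->
  \sum_(i < n) (chord R Q (2 ^ i.+1)%N)^-1 < (chord R Q 1)^-1.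
Proof.
move=> Q1 nQ; rewrite inv_chord_pow_sum; last by move: nQ; rewrite expnS; lia.
have Q0 : Q%:R != 0 :> R by rewrite pnatr_eq0; lia.
rewrite {1}/chord mulr1; set x := pi / Q%:R.
have -> : x * (2 ^ n)%:R = - (x / 2) + pi / 2.
  apply: (mulIf (_ : 2 != 0)); first by rewrite pnatr_eq0.
  rewrite -mulrA -(natrM _ _ 2) mulnC -expnS.
  have -> : (2 ^ n.+1)%:R = Q%:R - 1 :> R by rewrite -nQ natrD addrK.
  by rewrite /x; field.
rewrite cosDpihalf sinDpihalf sinN cosN opprK.
have x0 : 0 < x by rewrite divr_gt0 ?pi_gt0 // ltr0n; lia.
have xpi : x <= pi / 2.
  by rewrite ler_pM2l ?pi_gt0 // lef_pV2 ?posrE ?ltr0n ?ler_nat //; lia.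
have pi0 := pi_gt0 R.
have sx0 : 0 < sin x by apply: sin_gt0_pi; lra.
have sy0 : 0 < sin (x / 2) by apply: sin_gt0_pi; lra.
have cy0 : 0 < cos (x / 2) by apply: cos_gt0_pihalf; lra.
have : cos x / sin x <= (sin x)^-1.
  by rewrite ler_pdivrMr // mulVf ?gt_eqF // cos_le1.
have : 0 < sin (x / 2) / cos (x / 2) by rewrite divr_gt0.
lra.
Qed.

(** * Ratios modulo the maximal period *)

Lemma period_gcd (q Q g p : nat) : q = (g * Q)%N -> (0 < Q)%N ->
  period q p = Q -> gcdn p q = g.
Proof.
move=> qE Q0 pQ; have := divnK (dvdn_gcdr p q).
rewrite -/(period q p) pQ {2}qE mulnC => /eqP.
by rewrite eqn_pmul2r // => /eqP.
Qed.

Lemma ratio_exists (q g p p0 : nat) : gcdn p q = g -> (g %| p0)%N ->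
  exists N : int, (p%:Z * N = p0%:Z %[mod q%:Z])%Z.
Proof.
move=> pg /dvdnP[d ->]; have [u [v uv]] := Bezoutz p q.
exists (d%:Z * u); apply/eqz_modP; exists (- (d%:Z * v)).
have gE : g%:Z = u * p%:Z + v * q%:Z by rewrite uv -pg.
rewrite PoszM gE; ring.
Qed.

Lemma ratio_unique (q Q g p : nat) (z : int) : q = (g * Q)%N -> (0 < q)%N ->
  gcdn p q = g -> (q%:Z %| p%:Z * z)%Z -> (Q%:Z %| z)%Z.
Proof.
move=> qE q0 pg; have g0 : (0 < g)%N by move: q0; rewrite qE muln_gt0 => /andP[].
have gp : (g %| p)%N by rewrite -pg dvdn_gcdl.
have cop : coprime (p %/ g) Q.
  rewrite /coprime -(eqn_pmul2l g0) muln_gcdr muln1 -qE.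
  by rewrite mulnC divnK // pg.
have -> : p%:Z = g%:Z * (p %/ g)%N%:Z by rewrite -PoszM mulnC divnK.
rewrite qE PoszM -mulrA dvdz_mul2l; last by lia.
by rewrite Gauss_dvdzr // /coprimez /gcdz /= gcdnC; exact: cop.
Qed.

(** The reverse ratio [M] inverts [N] modulo [Q]. *)
Lemma ratio_coprime (q Q g p p0 : nat) (N : int) : q = (g * Q)%N -> (0 < q)%N ->
    gcdn p q = g -> gcdn p0 q = g -> (p%:Z * N = p0%:Z %[mod q%:Z])%Z ->
  coprimez N Q%:Z.
Proof.
move=> qE q0 pg p0g /eqz_modP[t tE].
have [M /eqz_modP[s sE]] : exists M : int, (p0%:Z * M = p%:Z %[mod q%:Z])%Z.
  by apply: ratio_exists p0g _; rewrite -pg dvdn_gcdl.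
have /(ratio_unique qE q0 pg)/dvdzP[n nE] : (q%:Z %| p%:Z * (N * M - 1))%Z.
  apply/dvdzP; exists (s + t * M).
  transitivity (p%:Z * N * M - p%:Z); first by ring.
  rewrite tE; transitivity (p0%:Z * M - p%:Z + t * q%:Z * M); first by ring.
  by rewrite sE; ring.
apply/coprimezP; exists (M, - n) => /=; rewrite mulNr -nE; ring.
Qed.

(** The distance from [z] to the nearest multiple of [Q]: the representative of [z] up to sign
    modulo [Q], which is all that the length of a chord sees. *)
Definition fold_mod (Q : nat) (z : int) : nat :=
  minn `|(z %% Q%:Z)%Z|%N (Q - `|(z %% Q%:Z)%Z|%N).

Lemma fold_modP (Q : nat) (z : int) : (0 < Q)%N ->
  exists t, z = (fold_mod Q z)%:Z + t * Q%:Z \/ z = - (fold_mod Q z)%:Z + t * Q%:Z.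
Proof.
move=> Q0; rewrite /fold_mod; have := modz_bound z Q0; have := divz_eq z Q%:Z.
move: (_ %/ _)%Z (_ %% _)%Z => u e -> eQ.
have [le_e|gt_e] := leqP `|e|%N (Q - `|e|).
  by exists u; left; lia.
by exists (u + 1); right; rewrite mulrDl; lia.
Qed.

Lemma fold_mod_le (Q : nat) (z : int) : (0 < Q)%N -> (fold_mod Q z <= Q./2)%N.
Proof. by move=> Q0; have := modz_bound z Q0; rewrite /fold_mod; lia. Qed.

Lemma coprime_fold_mod (Q : nat) (z : int) : (0 < Q)%N ->
  coprimez z Q%:Z -> coprime (fold_mod Q z) Q.
Proof.
move=> Q0 /coprimezP[[u v] /= uv]; have [t tE] := fold_modP z Q0.
suff : coprimez (fold_mod Q z) Q by [].
apply/coprimezP; case: tE => tE.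
  by exists (u, v + u * t); rewrite -[RHS]uv {2}tE /=; ring.
by exists (- u, v + u * t); rewrite -[RHS]uv {2}tE /=; ring.
Qed.

Lemma norm_chord_fold (R : realType) (Q : nat) (z : int) : (0 < Q)%N ->
  `|chord R Q z| = chord R Q (fold_mod Q z).
Proof.
move=> Q0; rewrite norm_chord_mod // /fold_mod; have := modz_bound z Q0.
set e := (_ %% _)%Z => eQ; have -> : e = `|e|%N by lia.
have {eQ} : (`|e| < Q)%N by lia.
move: (`|e|%N) => n nQ; rewrite absz_nat.
have chord_ge0 (a : nat) : (a <= Q)%N -> 0 <= chord R Q a.
  case: a => [|a]; first by rewrite /chord mulr0 sin0.
  rewrite leq_eqVlt => /orP[/eqP ->|aQ]; last by rewrite ltW // chord_gt0.
  by have := @chordDQ R Q 0 Q0; rewrite add0r /chord mulr0 sin0 oppr0 => ->.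
rewrite ger0_norm; last by apply: chord_ge0; lia.
have [//|nQn] := leqP n (Q - n).
have := @chordDQ R Q (- n%:Z) Q0; rewrite chordN opprK => <-; congr chord; lia.
Qed.

(** Of the zero-sum hypothesis only the pairs are kept; with injectivity they separate ratios up to
    sign. *)
Record max_period (q Q g m : nat) (p : 'I_m -> nat) : Prop := MaxPeriod {
  mp_Q : (1 < Q)%N;
  mp_g : (0 < g)%N;
  mp_q : q = (g * Q)%N;
  mp_range : forall k, (0 < p k < q)%N;
  mp_inj : injective p;
  mp_opp : forall k l, k != l -> (p k + p l)%N != q;
  mp_max : forall k, (period q (p k) <= Q)%N
}.

Definition top (q Q m : nat) (p : 'I_m -> nat) : pred 'I_m :=
  fun k => period q (p k) == Q.

Lemma dvdz_mul_coprime (q Q g : nat) (z N : int) : q = (g * Q)%N -> (0 < g)%N ->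
  (g%:Z %| z)%Z -> coprimez N Q%:Z -> (q%:Z %| z * N)%Z -> (q%:Z %| z)%Z.
Proof.
move=> -> g0 /dvdzP[y ->] NQ; rewrite PoszM [y * _]mulrC -mulrA !dvdz_mul2l; try lia.
by rewrite Gauss_dvdzl // /coprimez /gcdz gcdnC; exact: NQ.
Qed.

Lemma dvdz_mul_period (q Q g m : nat) (p : 'I_m -> nat) (k : 'I_m) (t : int) :
  max_period q Q g p -> top q Q p k -> (q%:Z %| (p k)%:Z * (t * Q%:Z))%Z.
Proof.
move=> mp /eqP kK; have gE := period_gcd (mp_q mp) (ltnW (mp_Q mp)) kK.
have /dvdnP[d ->] : (g %| p k)%N by rewrite -gE dvdn_gcdl.
by apply/dvdzP; exists (d%:Z * t); rewrite (mp_q mp) !PoszM; ring.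
Qed.

Lemma eq_of_dvdz_sub (q m : nat) (p : 'I_m -> nat) (k l : 'I_m) :
    (forall k, 0 < p k < q)%N -> injective p ->
  (q%:Z %| (p k)%:Z - (p l)%:Z)%Z -> k = l.
Proof.
move=> pr pi /dvdzP[t tE]; apply: pi; have := pr k; have := pr l => l1 k1.
have t0 : t = 0.
  by move: tE k1 l1; case: (ltrgt0P t) => // t1 tE; nia.
by move: tE; rewrite t0; lia.
Qed.

Lemma dvdz_add_opp (q m : nat) (p : 'I_m -> nat) (k l : 'I_m) :
    (forall k, 0 < p k < q)%N ->
  (q%:Z %| (p k)%:Z + (p l)%:Z)%Z -> (p k + p l)%N = q.
Proof.
move=> pr; rewrite -PoszD -[(_ %| _)%Z]/(q %| p k + p l)%N.
have := pr k; have := pr l => l1 k1.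
by case/dvdnP=> -[|[|n]]; rewrite ?mulSn; lia.
Qed.

(* [N k] represents [p k0 / p k]; it determines [p k] up to sign. *)
Lemma fold_ratio_inj (q Q g m : nat) (p : 'I_m -> nat) (N : 'I_m -> int)
    (k0 : 'I_m) : max_period q Q g p -> top q Q p k0 ->
    (forall k, top q Q p k -> ((p k)%:Z * N k = (p k0)%:Z %[mod q%:Z])%Z) ->
  {in top q Q p &, injective (fun k => fold_mod Q (N k))}.
Proof.
move=> mp k0K NP k l kK lK fkl.
have [Q1 g0 qE pr pi po pm] := mp; have Q0 := ltnW Q1.
have q0 : (0 < q)%N by rewrite qE muln_gt0 g0.
have gE j : top q Q p j -> gcdn (p j) q = g by move/eqP; exact: period_gcd.
have gp j : top q Q p j -> (g%:Z %| (p j)%:Z)%Z.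
  by move=> jK; rewrite -(gE j jK); exact: dvdn_gcdl.
have Nl := ratio_coprime qE q0 (gE l lK) (gE k0 k0K) (NP l lK).
have [tk tkE] := fold_modP (N k) Q0; have [tl tlE] := fold_modP (N l) Q0.
have /eqz_modP[sk skE] := NP k kK; have /eqz_modP[sl slE] := NP l lK.
(* Equal ratios give [p k = p l]; opposite ratios give [p k + p l = q], which is excluded for
   distinct indices. *)
have [[t NE]|[t NE]] : (exists t, N k = N l + t * Q%:Z) \/
    (exists t, N k = - N l + t * Q%:Z).
  move: tkE tlE; rewrite [fold_mod Q (N k)]fkl; move: (fold_mod Q (N l)) => f.
  move=> tkE tlE; case: tkE => ->; case: tlE => ->; [left|right|right|left].
  - by exists (tk - tl); ring.
  - by exists (tk + tl); ring.
  - by exists (tk + tl); ring.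
  - by exists (tk - tl); ring.
- apply: (eq_of_dvdz_sub pr pi).
  apply: (dvdz_mul_coprime qE g0 _ Nl); first by rewrite rpredB ?gp.
  have /dvdzP[u uE] := dvdz_mul_period t mp kK.
  apply/dvdzP; exists (sk - sl - u).
  transitivity ((p k)%:Z * N k - (p k)%:Z * (t * Q%:Z) - (p l)%:Z * N l).
    by rewrite NE; ring.
  by rewrite skE slE uE; ring.
- have [//|kl] := eqVneq k l; have /eqP[] := po k l kl.
  apply: (dvdz_add_opp pr); apply: (dvdz_mul_coprime qE g0 _ Nl).
    by rewrite rpredD ?gp.
  have /dvdzP[u uE] := dvdz_mul_period t mp kK.
  apply/dvdzP; exists (u - sk + sl).
  transitivity ((p k)%:Z * (t * Q%:Z) - (p k)%:Z * N k + (p l)%:Z * N l).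
    by rewrite NE; ring.
  by rewrite skE slE uE; ring.
Qed.

Lemma ratio_family (q Q g m : nat) (p : 'I_m -> nat) (k0 : 'I_m) :
    max_period q Q g p -> top q Q p k0 ->
  exists2 N : 'I_m -> int, N k0 = 1 &
    forall k, top q Q p k -> ((p k)%:Z * N k = (p k0)%:Z %[mod q%:Z])%Z.
Proof.
move=> mp k0K; have [Q1 g0 qE _ _ _ _] := mp.
have gE j : top q Q p j -> gcdn (p j) q = g.
  by move/eqP; apply: period_gcd qE (ltnW Q1).
have ex k : exists N, top q Q p k -> ((p k)%:Z * N = (p k0)%:Z %[mod q%:Z])%Z.
  case: (boolP (top q Q p k)) => kK; last by exists 0.
  have [|N NE] := @ratio_exists q g (p k) (p k0) (gE k kK).
    by rewrite -(gE k0 k0K) dvdn_gcdl.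
  by exists N.
exists (fun k => if k == k0 then 1 else sval (cid (ex k))); first by rewrite eqxx.
by move=> k kK; case: eqP => [->|_]; [rewrite mulr1|case: cid => N /=; apply].
Qed.

Lemma fold_mod1 (Q : nat) : (1 < Q)%N -> fold_mod Q 1 = 1%N.
Proof. by move=> Q1; rewrite /fold_mod modz_small /=; lia. Qed.

Lemma fold_ratio_bounds (q Q g m : nat) (p : 'I_m -> nat) (N : 'I_m -> int)
    (k0 k : 'I_m) : max_period q Q g p -> top q Q p k0 -> top q Q p k ->
    ((p k)%:Z * N k = (p k0)%:Z %[mod q%:Z])%Z ->
  [&& 0 < fold_mod Q (N k), fold_mod Q (N k) <= Q./2 & coprime (fold_mod Q (N k)) Q]%N.
Proof.
move=> mp k0K kK NE; have [Q1 g0 qE _ _ _ _] := mp; have Q0 := ltnW Q1.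
have gE j : top q Q p j -> gcdn (p j) q = g by move/eqP; exact: period_gcd.
have q0 : (0 < q)%N by rewrite qE muln_gt0 g0.
have cop := coprime_fold_mod Q0 (ratio_coprime qE q0 (gE k kK) (gE k0 k0K) NE).
rewrite fold_mod_le // cop !andbT lt0n; apply: contraTneq cop => ->.
by rewrite /coprime gcd0n; lia.
Qed.

(** Folded ratios embed the contributing indices into the units modulo [Q] up to sign. The count
    later discards small divisors of [2^d - 1] and [2^d + 1]. *)
Lemma card_top_le (q Q g m : nat) (p : 'I_m -> nat) (k0 : 'I_m) :
    max_period q Q g p -> top q Q p k0 ->
  (#|top q Q p| <= size [seq a <- iota 1 Q./2 | coprime a Q])%N.
Proof.
move=> mp k0K; have [N _ NP] := ratio_family mp k0K.
rewrite cardE -(size_map (fun k => fold_mod Q (N k))); apply: uniq_leq_size.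
  rewrite map_inj_in_uniq ?enum_uniq // => k l; rewrite !mem_enum.
  exact: (fold_ratio_inj mp k0K NP).
move=> a /mapP[k]; rewrite mem_enum => kK ->.
have /and3P[a0 aQ ac] := fold_ratio_bounds mp k0K kK (NP k kK).
by rewrite mem_filter ac mem_iota a0 /= add1n ltnS.
Qed.

Lemma halving (R : realType) (q Q g m c : nat) (p : 'I_m -> nat)
    (r : 'I_m -> int) (k0 : 'I_m) :
    max_period q Q g p -> top q Q p k0 ->
    perfect_fold_covering c (fun k => beatty (p k) q (r k)) ->
    (#|top q Q p| <= 4)%N || (#|top q Q p| == 5) && (24 <= Q)%N ->
  exists k, [/\ top q Q p k, k != k0 &
    (q%:Z %| (p k)%:Z * 2 - (p k0)%:Z)%Z \/ (q%:Z %| (p k)%:Z * 2 + (p k0)%:Z)%Z].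
Proof.
move=> mp k0K cov cardK; have [N N0 NP] := ratio_family mp k0K.
have [Q1 g0 qE pr _ _ pm] := mp; have Q0 := ltnW Q1.
have NP' k : period q (p k) = Q -> ((p k)%:Z * N k = (p k0)%:Z %[mod q%:Z])%Z.
  by move/eqP; exact: NP.
have := beatty_chord_sum R Q1 g0 qE pr pm (eqP k0K) NP' cov.
have u1 k : top q Q p k -> `|eta R Q ^ (2 * (p k0 %/ g)%N%:Z * r k + N k)| = 1.
  by move=> _; rewrite cis_exprz norm_cis.
move/(unit_sum_triangle k0K u1); rewrite N0 normfV norm_chord_fold // fold_mod1 //.
pose f k := fold_mod Q (N k).
have f_inj := fold_ratio_inj mp k0K NP.
pose s := [seq f k | k <- enum [pred k | top q Q p k && (k != k0)]].
have -> : \sum_(i | (period q (p i) == Q) && (i != k0)) `|(chord R Q (N i))^-1| =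
    \sum_(a <- s) (chord R Q a)^-1.
  rewrite big_map big_enum_cond /=; apply: eq_big => k; first by rewrite andbT.
  by move=> _; rewrite normfV norm_chord_fold.
have su : uniq s.
  rewrite map_inj_in_uniq ?enum_uniq // => k l; rewrite !mem_enum !inE.
  by move=> /andP[kK _] /andP[lK _]; apply: f_inj.
have sP : all (fun a => [&& 2 <= a, a <= Q./2 & coprime a Q])%N s.
  apply/allP => a /mapP[k]; rewrite mem_enum inE => /andP[kK kk0] ->.
  have /and3P[a0 -> ->] := fold_ratio_bounds mp k0K kK (NP k kK).
  rewrite !andbT ltn_neqAle a0 andbT eq_sym; apply: contraNneq kk0 => fk.
  apply/eqP; apply: f_inj => //=; rewrite N0 fold_mod1 //.
have s_size : (size s).+1 = #|top q Q p|.
  rewrite size_map -cardE [RHS](cardD1 k0).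
  have -> : k0 \in top q Q p by exact: k0K.
  by rewrite add1n; congr _.+1; apply: eq_card => k; rewrite !inE andbC.
move=> sum_ge; have : 2%N \in s.
  by apply: two_mem su sP _ Q1 sum_ge; rewrite -ltnS -eqSS s_size.
case/mapP => k; rewrite mem_enum inE => /andP[kK kk0] fk.
exists k; split=> //; have /eqz_modP[u uE] := NP k kK.
have [t] := fold_modP (N k) Q0; rewrite -[fold_mod _ _]fk => tE.
have /dvdzP[w wE] := dvdz_mul_period t mp kK.
case: tE => tE; [left|right]; apply/dvdzP; [exists (u - w)|exists (w - u)].
  transitivity ((p k)%:Z * N k - (p k)%:Z * (t * Q%:Z) - (p k0)%:Z).
    by rewrite tE; ring.
  by rewrite uE wE; ring.
transitivity ((p k)%:Z * (t * Q%:Z) - (p k)%:Z * N k + (p k0)%:Z).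
  by rewrite tE; ring.
by rewrite uE wE; ring.
Qed.

(** * The orbit of halving *)

Definition pow2_pm1 (Q d : nat) : bool := (Q %| 2 ^ d - 1)%N || (Q %| 2 ^ d + 1)%N.

Lemma pow2_pm1P (Q d : nat) (b : bool) :
  (Q%:Z %| 2 ^+ d - (-1) ^+ b)%Z -> pow2_pm1 Q d.
Proof.
have E : 2 ^+ d = (2 ^ d)%N%:Z :> int by rewrite -[RHS]natz natrX.
rewrite /pow2_pm1 E; case: b => /=.
  by rewrite expr1 opprK => Qd; apply/orP; right.
rewrite expr0 => Qd; apply/orP; left.
have F : (2 ^ d)%N%:Z - 1 = (2 ^ d - 1)%N%:Z by rewrite -subzn ?expn_gt0.
by move: Qd; rewrite F.
Qed.

(** As [d <= 5], [Q] divides a positive number at most 33, and enumeration decides. The unit count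
    removes divisors such as 3 and 5 for [n = 4]; the bound 24 removes 11 and 17 for [n = 5], where
    [2^5] resp. [2^4] is -1. *)
Lemma pow2_pm1_determines (Q n d : nat) : (1 < Q)%N -> (2 <= n <= 5)%N ->
    (n <= size [seq a <- iota 1 Q./2 | coprime a Q])%N ->
    (n == 5) ==> (24 <= Q)%N -> (0 < d <= n)%N -> pow2_pm1 Q d ->
  [/\ d = n, (2 ^ n == Q.+1)%N || (2 ^ n + 1 == Q)%N &
      forall d', (0 < d' < n)%N -> ~~ pow2_pm1 Q d'].
Proof.
move=> Q1 n_range n_size n5 d_range Qd.
have Q33 : (Q <= 33)%N.
  have pow_le : (2 ^ d <= 2 ^ 5)%N by rewrite leq_exp2l //; lia.
  have d2 : (2 ^ 1 <= 2 ^ d)%N by rewrite leq_exp2l //; lia.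
  by move: Qd; rewrite /pow2_pm1 => /orP[] /dvdn_leq; lia.
pose ok Q n d := [&& (n <= size [seq a <- iota 1 Q./2 | coprime a Q])%N,
    (n == 5) ==> (24 <= Q)%N & pow2_pm1 Q d] ==>
  [&& d == n, (2 ^ n == Q.+1)%N || (2 ^ n + 1 == Q)%N &
   all (fun d' => ~~ pow2_pm1 Q d') (iota 1 n.-1)].
have all_ok : all (fun Q => all (fun n => all (ok Q n) (iota 1 n)) (iota 2 4)) (iota 2 32).
  by vm_compute.
have Q_in : Q \in iota 2 32 by rewrite mem_iota; lia.
have n_in : n \in iota 2 4 by rewrite mem_iota; lia.
have d_in : d \in iota 1 n by rewrite mem_iota; lia.
have := allP (allP (allP all_ok Q Q_in) n n_in) d d_in.
rewrite /ok n_size n5 Qd /= => /and3P[/eqP dn Qn /allP nd]; split=> // d' d'n.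
by apply: nd; rewrite mem_iota; lia.
Qed.

Lemma halving_orbit (q m : nat) (p : 'I_m -> nat) (K : pred 'I_m) (k0 : 'I_m) :
    K k0 ->
    (forall k0, K k0 -> exists k, [/\ K k, k != k0 &
      (q%:Z %| (p k)%:Z * 2 - (p k0)%:Z)%Z \/
      (q%:Z %| (p k)%:Z * 2 + (p k0)%:Z)%Z]) ->
  exists kk : nat -> 'I_m, [/\ kk 0%N = k0, forall i, K (kk i) &
    forall i d, exists b : bool,
      (q%:Z %| (p (kk (i + d)%N))%:Z * 2 ^+ d - (-1) ^+ b * (p (kk i))%:Z)%Z].
Proof.
move=> k0K half.
have ex k : exists l, K k -> K l /\
    exists b : bool, (q%:Z %| (p l)%:Z * 2 - (-1) ^+ b * (p k)%:Z)%Z.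
  case: (boolP (K k)) => kK; last by exists k.
  have [l [lK _ lP]] := half k kK; exists l => _; split=> //.
  case: lP => lP; [exists false|exists true]; first by rewrite expr0 mul1r.
  by rewrite expr1 mulN1r opprK.
pose h k := sval (cid (ex k)).
have hP k : K k -> K (h k) /\
    exists b : bool, (q%:Z %| (p (h k))%:Z * 2 - (-1) ^+ b * (p k)%:Z)%Z.
  by rewrite /h; case: cid.
exists (fun i => iter i h k0).
have iterK i : K (iter i h k0) by elim: i => //= i /hP[].
split=> // i; elim=> [|d [b IHd]].
  by exists false; rewrite addn0 expr0 mulr1 expr0 mul1r subrr dvdz0.
have [_ [b' hb']] := hP _ (iterK (i + d)%N).
exists (b (+) b'); rewrite addnS /= signr_addb.
set x := (p (h _))%:Z in hb' *; set y := (p (iter (i + d) _ _))%:Z in hb' IHd.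
have -> : x * 2 ^+ d.+1 - (-1) ^+ b * (-1) ^+ b' * (p (iter i h k0))%:Z =
  (x * 2 - (-1) ^+ b' * y) * 2 ^+ d +
  (y * 2 ^+ d - (-1) ^+ b * (p (iter i h k0))%:Z) * (-1) ^+ b'.
  by rewrite exprS; ring.
by rewrite rpredD // dvdz_mulr.
Qed.

(** Exponents of [eta] count modulo the even number [2 Q]. A negative sign would equate the even
    exponent [2 x - 2^i] with the odd [2 y + 1]; otherwise the minus sign is absorbed as
    [eta ^ Q]. *)
Lemma eta_phase (R : realType) (Q i : nat) (x y : int) (b : bool) :
    (0 < Q)%N -> (0 < i)%N ->
    eta R Q ^ (2 * x + (-1) ^+ b * 2 ^+ i) = - ((-1) ^+ b) * eta R Q ^ (2 * y + 1) ->
  b = false /\ (2 * Q%:Z %| 2 * x + 2 ^+ i - (2 * y + 1 + Q%:Z))%Z.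
Proof.
move=> Q0 i0; have eta0 : eta R Q != 0 := cis_neq0 _.
have etaQ : eta R Q ^ Q%:Z = -1 := eta_order R Q0.
have prim := eta_prim R Q0.
have Q2 : (Q.*2)%:Z = 2 * Q%:Z by lia.
case: b; rewrite /= ?expr1 ?expr0 => /eqP.
  rewrite opprK mul1r (exprz_prim_eq _ _ prim) Q2 => /dvdzP[t].
  by case: i i0 => // i _; rewrite exprS => E; exfalso; lia.
rewrite mul1r -etaQ -expfzDr // (exprz_prim_eq _ _ prim) Q2 => E; split=> //.
by rewrite -[2 * y + 1 + _]addrC.
Qed.

(** Among [n + 1] points of the orbit two coincide; a coincidence at distance [d] makes [2^d] equal
    to 1 or -1 modulo [Q], which forces [d = n]. The first [n] points are therefore distinct and
    exhaust the contributing indices. *)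
Lemma orbit_card (q Q g m : nat) (p : 'I_m -> nat) (kk : nat -> 'I_m)
    (n := #|top q Q p|) :
    max_period q Q g p -> (forall i, top q Q p (kk i)) ->
    (forall i d, exists b : bool,
      (q%:Z %| (p (kk (i + d)%N))%:Z * 2 ^+ d - (-1) ^+ b * (p (kk i))%:Z)%Z) ->
    (2 <= n <= 5)%N -> (n == 5) ==> (24 <= Q)%N ->
  [/\ (2 ^ n == Q.+1)%N || (2 ^ n + 1 == Q)%N, kk n = kk 0%N &
      perm_eq (enum (top q Q p)) [seq kk i | i <- iota 0 n]].
Proof.
move=> mp kkK kkP n_range n5.
have [Q1 g0 qE pr pi po pm] := mp; have Q0 := ltnW Q1.
have q0 : (0 < q)%N by rewrite qE muln_gt0 g0.
have n_size := card_top_le mp (kkK 0%N).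
have coincide i d : kk (i + d)%N = kk i -> pow2_pm1 Q d.
  move=> E; have [b] := kkP i d; rewrite E => div.
  apply: (@pow2_pm1P Q d b).
  apply: (ratio_unique qE q0 (period_gcd qE Q0 (eqP (kkK i)))).
  by rewrite mulrBr [_ * (-1) ^+ _]mulrC.
have det d := pow2_pm1_determines Q1 n_range n_size n5 (d := d).
have nuniq : ~~ uniq [seq kk i | i <- iota 0 n.+1].
  apply/negP => /card_uniqP; rewrite size_map size_iota => card_n.
  have : (#|[seq kk i | i <- iota 0 n.+1]| <= n)%N.
    have sub : [seq kk i | i <- iota 0 n.+1] \subset top q Q p.
      by apply/fintype.subsetP => k /mapP[i _ ->]; exact: kkK.
    exact: subset_leq_card sub.
  by rewrite card_n ltnn.
have [i [j [ij jn kij]]] : exists i j, [/\ (i < j)%N, (j <= n)%N & kk j = kk i].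
  have /(uniqPn (kk 0%N))[i [j [ij]]] := nuniq.
  rewrite size_map size_iota ltnS => jn.
  rewrite !(nth_map 0%N) ?size_iota ?nth_iota ?add0n; try lia.
  by exists i, j.
have jE : (i + (j - i))%N = j by lia.
have dn : (0 < j - i <= n)%N by lia.
have [djn Qn nd] := det _ dn (coincide i (j - i)%N (etrans (congr1 kk jE) kij)).
have [i0 jn'] : i = 0%N /\ j = n by lia.
split=> //; first by rewrite -i0 -jn'.
have kk_uniq : uniq [seq kk i | i <- iota 0 n].
  apply: contraT => /(uniqPn (kk 0%N))[a [b [ab]]].
  rewrite size_map size_iota => bn.
  rewrite !(nth_map 0%N) ?size_iota ?nth_iota ?add0n; try lia.
  move=> kab; have := nd (b - a)%N; rewrite (@coincide a) /=; first by lia.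
  by rewrite subnKC ?kab // ltnW.
apply: uniq_perm => //; first exact: enum_uniq.
have sub : {subset [seq kk i | i <- iota 0 n] <= enum (top q Q p)}.
  by move=> k /mapP[a _ ->]; rewrite mem_enum; exact: kkK.
have [|_ E] := uniq_min_size kk_uniq sub; last by move=> k; rewrite E.
by rewrite size_map size_iota -cardE.
Qed.

Lemma top_structure (R : realType) (q Q g m c : nat) (p : 'I_m -> nat)
    (r : 'I_m -> int) (k0 : 'I_m) (n := #|top q Q p|) :
    max_period q Q g p -> top q Q p k0 ->
    perfect_fold_covering c (fun k => beatty (p k) q (r k)) ->
    (n <= 4)%N || (n == 5) && (24 <= Q)%N ->
  (2 ^ n = Q.+1)%N /\ exists kk : nat -> 'I_m,
    [/\ kk n = kk 0%N, kk 0%N = k0,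
        perm_eq (enum (top q Q p)) [seq kk i | i <- iota 0 n],
        forall i, (i < n)%N ->
          (q%:Z %| (p (kk i.+1))%:Z * 2 ^+ i.+1 - (p k0)%:Z)%Z &
        forall i, (i < n)%N ->
          (Q%:Z %| (p k0 %/ g)%N%:Z * (r (kk i.+1) - r k0) + 2 ^+ i - 2 ^+ n.-1)%Z].
Proof.
move=> mp k0K cov cardK.
have [Q1 g0 qE pr pi po pm] := mp; have Q0 := ltnW Q1.
have q0 : (0 < q)%N by rewrite qE muln_gt0 g0.
have half k : top q Q p k -> _ := fun kK => halving R mp kK cov cardK.
have n2 : (2 <= n)%N.
  have [k [kK kk0 _]] := half k0 k0K.
  have := subset_leq_card (_ : [pred x | x \in [:: k; k0]] \subset top q Q p).
  rewrite (@eq_card _ _ (mem [:: k; k0])); last by move=> x; rewrite !inE.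
  rewrite (card_uniqP _) /= ?inE ?kk0 //; apply.
  by apply/fintype.subsetP => x; rewrite !inE => /orP[] /eqP ->.
have n_range : (2 <= n <= 5)%N by lia.
have n5 : (n == 5) ==> (24 <= Q)%N by lia.
have [kk [kk0 kkK kkP]] := halving_orbit k0K half.
have [Qn kkn kk_perm] : [/\ (2 ^ n == Q.+1)%N || (2 ^ n + 1 == Q)%N, kk n = kk 0%N &
    perm_eq (enum (top q Q p)) [seq kk i | i <- iota 0 n]].
  exact: orbit_card mp kkK kkP n_range n5.
(* The sign at index 0 is fixed as positive, so that the ratio of [k0] to itself is 1. *)
have exb i : exists b : bool, ((i == 0%N) ==> ~~ b) &&
    (q%:Z %| (p (kk i))%:Z * 2 ^+ i - (-1) ^+ b * (p k0)%:Z)%Z.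
  case: i => [|i]; last by have [b] := kkP 0%N i.+1; rewrite add0n kk0; exists b.
  by exists false; rewrite kk0 expr0 mulr1 mul1r subrr dvdz0.
pose b i := sval (cid (exb i)).
have bP i : ((i == 0%N) ==> ~~ b i) /\
    (q%:Z %| (p (kk i))%:Z * 2 ^+ i - (-1) ^+ b i * (p k0)%:Z)%Z.
  by rewrite /b; case: cid => ? /= /andP.
have b0 : b 0%N = false by have [/negbTE] := bP 0%N.
pose s := [seq kk i | i <- iota 0 n].
have s_uniq : uniq s by rewrite -(perm_uniq kk_perm) enum_uniq.
pose M i : int := (-1) ^+ b i * 2 ^+ i.
pose N k : int := M (index k s).
have kk_index i : (i < n)%N -> index (kk i) s = i.
  move=> i_n; have {1}-> : kk i = nth (kk 0%N) s i.
    by rewrite (nth_map 0%N) ?size_iota // nth_iota.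
  by rewrite index_uniq // size_map size_iota.
have topE k : top q Q p k -> exists2 i, (i < n)%N & k = kk i.
  move=> kK; have : k \in s by rewrite -(perm_mem kk_perm) mem_enum.
  by case/mapP => i; rewrite mem_iota => i_n ->; exists i.
have NP k : period q (p k) = Q -> ((p k)%:Z * N k = (p k0)%:Z %[mod q%:Z])%Z.
  move=> /eqP/topE[i i_n ->]; rewrite /N kk_index //.
  have [_ /dvdzP[t tE]] := bP i; apply/eqz_modP; exists ((-1) ^+ b i * t).
  have sq : (-1) ^+ b i * (-1) ^+ b i = 1 :> int by rewrite -signr_addb addbb.
  transitivity ((-1) ^+ b i * ((p (kk i))%:Z * 2 ^+ i)); first by rewrite /M; ring.
  have -> : (p (kk i))%:Z * 2 ^+ i = t * q%:Z + (-1) ^+ b i * (p k0)%:Z.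
    by rewrite -tE subrK.
  by rewrite mulrDr mulrA sq; ring.
have := beatty_chord_sum R Q1 g0 qE pr pm (eqP k0K) NP cov.
set p' := (p k0 %/ g)%N%:Z.
rewrite -big_filter (perm_big s); last by rewrite deprecated_filter_index_enum.
rewrite big_map -[n]subn0 big_mkord subn0 => sum0.
have {}sum0 : \sum_(i < n) eta R Q ^ (2 * (p' * r (kk i)) + M i) *
    ((chord R Q (M i))^-1)%:C%C = 0.
  rewrite -[RHS]sum0; apply: eq_bigr => i _.
  by rewrite /N kk_index // mulrA.
clear s s_uniq N kk_index topE NP half; clearbody n.
case: n cardK n2 n_range n5 Qn kkn kk_perm sum0 => // n.
move=> _ n2 n_range n5 Qn kkn kk_perm sum0.
have pow_lt i : (i < n.+1)%N -> (0 < 2 ^ i < Q)%N.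
  rewrite ltnS => i_n; rewrite expn_gt0 /=.
  have : (2 ^ i <= 2 ^ n)%N by rewrite leq_exp2l.
  have : (2 <= 2 ^ n)%N by rewrite -{1}[2%N]expn1 leq_exp2l //; lia.
  by case/orP: Qn => /eqP; rewrite [(2 ^ n.+1)%N]expnS; lia.
pose u (i : 'I_n.+1) := eta R Q ^ (2 * (p' * r (kk i)) + M i).
pose z (i : 'I_n.+1) := (chord R Q (M i))^-1.
have {}sum0 : \sum_(i < n.+1) u i * (z i)%:C%C = 0 by exact: sum0.
have chordM i : chord R Q (M i) = (-1) ^+ b i * chord R Q (2 ^ i)%N.
  rewrite /M; have -> : 2 ^+ i = (2 ^ i)%N%:Z :> int by rewrite -[RHS]natz natrX.
  by case: (b i); rewrite ?expr1 ?expr0 ?mul1r // mulN1r chordN mulN1r.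
have chord_pos i : (i < n.+1)%N -> 0 < chord R Q (2 ^ i)%N.
  by move=> /pow_lt; apply: chord_gt0.
have z_norm (i : 'I_n.+1) : `|z i| = (chord R Q (2 ^ i)%N)^-1.
  by rewrite /z chordM normfV normrM normrX normrN1 expr1n mul1r gtr0_norm // chord_pos.
have z0 : z ord0 = (chord R Q 1)^-1 by rewrite /z chordM b0 mul1r.
have z0_gt0 : 0 < z ord0 by rewrite z0 invr_gt0 (chord_pos 0%N).
have u1 (i : 'I_n.+1) : true -> `|u i| = 1 by move=> _; rewrite /u cis_exprz norm_cis.
have tail : \sum_(i < n.+1 | true && (i != ord0)) `|z i| =
    \sum_(i < n) (chord R Q (2 ^ i.+1)%N)^-1.
  rewrite big_mkcond big_ord_recl eqxx /= add0r; apply: eq_bigr => i _.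
  by rewrite z_norm.
have tri : (chord R Q 1)^-1 <= \sum_(i < n) (chord R Q (2 ^ i.+1)%N)^-1.
  rewrite -tail -z0 -[z ord0]gtr0_norm //.
  exact: (@unit_sum_triangle R _ xpredT ord0 u z isT u1 sum0).
have {Qn}Qn : (2 ^ n.+1 = Q.+1)%N.
  (* If [Q] is a power of two plus one, the term of [k0] strictly outweighs all others together,
     against [tri]. *)
  case/orP: Qn => /eqP // Qn; move: tri.
  by rewrite leNgt inv_chord_fermat.
(* The triangle inequality is now an equality, so each phase is minus that of [k0] up to the sign
   [b i.+1], which [eta_phase] determines. *)
have phase i : (i < n)%N -> b i.+1 = false /\
    (2 * Q%:Z %| 2 * (p' * r (kk i.+1)) + 2 ^+ i.+1 -
       (2 * (p' * r (kk 0%N)) + 1 + Q%:Z))%Z.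
  move=> i_n; apply: (@eta_phase R) => //; pose i' : 'I_n.+1 := lift ord0 (Ordinal i_n).
  have zi' : z i' != 0 by rewrite -normr_eq0 z_norm gt_eqF // invr_gt0 chord_pos.
  have eqn : `|z ord0| = \sum_(i < n.+1 | true && (i != ord0)) `|z i|.
    by rewrite tail inv_chord_mersenne // gtr0_norm.
  have := @unit_sum_triangle_eq R _ xpredT ord0 i' u z isT u1 sum0 eqn z0_gt0 isT
    isT zi'.
  have -> : Num.sg (z i') = (-1) ^+ b i.+1.
    have cp := chord_pos i.+1 i_n; rewrite /z [i' : nat]/= chordM.
    case: (b _); rewrite ?expr1 ?expr0 ?mulN1r ?mul1r ?invrN ?sgrN gtr0_sg //;
      by rewrite invr_gt0.
  by rewrite rmorphXn rmorphN1 /u /M b0 expr0 mul1r => ->.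
split=> //; exists kk; split=> //.
  move=> i; rewrite ltnS leq_eqVlt => /orP[/eqP ->|i_n].
    rewrite kkn kk0 -natz; have -> : 2 ^+ n.+1 = 1 + 1 * Q%:Z :> int.
      by rewrite mul1r -[RHS]/((1 + Q)%N%:Z) add1n -Qn -[RHS]natz natrX.
    rewrite natz mulrDr mulr1 addrAC subrr add0r.
    exact: dvdz_mul_period mp k0K.
  have [_ div] := bP i.+1.
  have [bi _] := phase i i_n; rewrite bi expr0 mul1r in div.
  exact: div.
move=> i; rewrite ltnS leq_eqVlt => /orP[/eqP ->|i_n].
  by rewrite kkn kk0 subrr mulr0 add0r subrr dvdz0.
have [_ /dvdzP[t tE]] := phase i i_n.
apply/dvdzP; exists t; apply: (@mulfI _ 2) => //.
(* All terms of the congruence modulo [2 Q] become even, so it halves to one modulo [Q]. *)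
have Qn' : Q%:Z + 1 = 2 * 2 ^+ n :> int.
  by rewrite -exprS -[Q%:Z + 1]/((Q + 1)%N%:Z) addn1 -Qn -[LHS]natz natrX.
rewrite [2 * (t * _)]mulrCA -tE exprS kk0 /=; move: Qn'; lra.
Qed.

(** * Coverings by powers of two, and the theorem *)

(** [h] is the inverse of 2 modulo [q]. Exactly one of two things happens: doubling [a] wraps, when
    [a >= h], or subtracting [h] from [a] wraps, when [a < h]. This makes the correction
    constant. *)
Lemma doubling_step (q : nat) (a a' y h : int) :
    0 <= a < q%:Z -> 0 <= a' < q%:Z -> 2 * h = q%:Z + 1 ->
    (q%:Z %| a' - 2 * a)%Z -> 0 <= y < q%:Z -> (q%:Z %| y - (a - h))%Z ->
  y = a' - a + (q%:Z - h).
Proof.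
move=> a_q a'_q hE /dvdzP[t tE] y_q /dvdzP[t' t'E].
have t_range : t = 0 \/ t = -1 by nia.
have t'_range : t' = 0 \/ t' = 1 by nia.
by case: t_range t'_range tE t'E => -> [] -> tE t'E; lia.
Qed.

(** By [doubling_step] the sum of residues telescopes around the cycle of doublings, so it is
    constant in [x], and a unit step then fixes the number of sets containing [x]. *)
Lemma cover_of_doubling (q m : nat) (p : 'I_m -> nat) (r : 'I_m -> int) (s : 'S_m)
    (delta gamma deltabar : int) :
    (forall k, 0 < p k < q)%N -> odd q -> (2 ^ m = 1 %[mod q])%N ->
    (delta * deltabar = 1 %[mod q%:Z])%Z ->
    (forall k : 'I_m,
      ((p (s k))%:Z = delta * 2 ^+ (m - k.+1) %[mod q%:Z])%Z /\
      (r (s k) = gamma - deltabar * 2 ^+ k %[mod q%:Z])%Z) ->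
  perfect_covering (fun k : 'I_m => beatty (p k) q (r k)).
Proof.
move=> pr q_odd pow_m dd prs.
have q0 : (0 < q)%N by case: (q) q_odd.
pose F x : int := \sum_k beatty_resid (p k) q (r k) x.
pose h : int := (q.+1)./2%:Z.
have hE : 2 * h = q%:Z + 1 by rewrite /h; have := odd_double_half q; rewrite q_odd; lia.
have Fconst x : F x = (q%:Z - h) *+ m.
  pose a i : int := ((2 ^+ i * (delta * (gamma - x))) %% q%:Z)%Z.
  have a_q i : 0 <= a i < q%:Z by apply: modz_bound.
  have a_double i : (q%:Z %| a i.+1 - 2 * a i)%Z.
    rewrite /a; set X := 2 ^+ i.+1 * _; set Y := 2 ^+ i * _.
    have XY : X = 2 * Y by rewrite /X /Y exprS; ring.
    apply/dvdzP; exists (2 * (Y %/ q%:Z)%Z - (X %/ q%:Z)%Z).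
    have := divz_eq X q%:Z; have := divz_eq Y q%:Z; rewrite XY; lia.
  have pow_mz : exists t, 2 ^+ m = 1 + t * q%:Z :> int.
    apply/eqz_modP; have -> : 2 ^+ m = (2 ^ m)%N%:Z :> int.
      by rewrite -[RHS]natz natrX.
    by rewrite !modz_nat pow_m.
  have [t tE] := pow_mz.
  have am : a m = a 0%N.
    by apply/eqz_modP; exists (t * (delta * (gamma - x))); rewrite tE expr0; ring.
  (* In reversed order the weight is [delta * 2 ^+ i], and the residue is [a i] minus [2 ^+ m.-1],
     which is [h] modulo [q] because [2 ^+ m] is 1. *)
  have yE (i : 'I_m) : beatty_resid (p (s (rev_ord i))) q (r (s (rev_ord i))) x =
      a i.+1 - a i + (q%:Z - h).
    apply: (doubling_step (a_q i) (a_q i.+1) hE) => //; first exact: modz_bound.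
    have i_m := ltn_ord i; have [] := prs (rev_ord i).
    have -> : (m - (rev_ord i).+1)%N = i by rewrite /=; lia.
    rewrite [nat_of_ord (rev_ord i)]/=.
    set P := p _; set rr := r _; move=> /eqz_modP[u uE] /eqz_modP[v vE].
    have m0 : (0 < m)%N by apply: leq_ltn_trans (ltn_ord i).
    have half_pow : exists w, 2 ^+ m.-1 = h + w * q%:Z :> int.
      have /dvdzP[w wE] : (q%:Z %| 2 ^+ m.-1 - h)%Z.
        rewrite -(@Gauss_dvdzr _ 2); last first.
          by rewrite -[coprimez _ _]/(coprime q 2) coprimen2.
        apply/dvdzP; exists (t - 1).
        by rewrite mulrBr -exprS prednK // tE hE; ring.
      by exists w; rewrite -wE; ring.
    have [w wE] := half_pow; have /eqz_modP[d dE] := dd.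
    have powE : 2 ^+ i * 2 ^+ (m - i.+1) = 2 ^+ m.-1 :> int.
      by rewrite -exprD; congr (_ ^+ _); lia.
    rewrite /beatty_resid /a -/P -/rr; set A := 2 ^+ i * _; set X := P%:Z * _.
    have XE : X = A - h +
        (u * (rr - x) + delta * 2 ^+ i * v - d * 2 ^+ m.-1 - w) * q%:Z.
      transitivity (A - delta * deltabar * (2 ^+ i * 2 ^+ (m - i.+1)) +
        (u * (rr - x) + delta * 2 ^+ i * v) * q%:Z).
        by rewrite /X /A uE vE; ring.
      by rewrite powE dE wE; ring.
    apply/dvdzP; exists (u * (rr - x) + delta * 2 ^+ i * v - d * 2 ^+ m.-1 - w -
      (X %/ q%:Z)%Z + (A %/ q%:Z)%Z).
    have -> : (X %% q%:Z)%Z = X - (X %/ q%:Z)%Z * q%:Z.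
      by rewrite {2}(divz_eq X q%:Z); ring.
    have -> : (A %% q%:Z)%Z = A - (A %/ q%:Z)%Z * q%:Z.
      by rewrite {2}(divz_eq A q%:Z); ring.
    by rewrite {1}XE; ring.
  rewrite /F (reindex_inj (@perm_inj _ s)) (reindex_inj rev_ord_inj) /=.
  under eq_bigr do rewrite yE.
  rewrite big_split /= sumr_const card_ord -[RHS]add0r; congr (_ + _).
  rewrite -(big_mkord xpredT (fun i => a i.+1 - a i)) telescope_sumr // am subrr.
  by [].
have sumE x : ((\sum_k (beatty_resid (p k) q (r k) x < (p k)%:Z)%R) * q)%N =
    (\sum_k p k)%N.
  apply/eqP; rewrite -eqz_nat PoszM; apply/eqP.
  have : F (x + 1) = F x - (\sum_k (p k)%:Z) +
      (\sum_k (beatty_resid (p k) q (r k) x < (p k)%:Z)%R)%N%:Z * q%:Z.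
    rewrite /F -[X in X * _]natz natr_sum mulr_suml -sumrB -big_split /=.
    apply: eq_bigr => k _; rewrite (@beatty_residD _ _ (p k)) ?mulr1 //.
      by rewrite natz mulrC.
    by have /andP[] := pr k.
  have <- : \sum_k (p k)%:Z = (\sum_k p k)%N%:Z.
    by rewrite -[RHS]natz natr_sum; apply: eq_bigr => k _; rewrite natz.
  by rewrite !Fconst; lia.
set c := (\sum_k (beatty_resid (p k) q (r k) 0 < (p k)%:Z)%R)%N.
exists c; have [_] := @beatty_coverE q m c p r pr; apply=> x.
by apply/eqP; rewrite -(eqn_pmul2r q0) !sumE.
Qed.

Lemma sum_pow2_rev (n : nat) : \sum_(i < n) 2 ^+ (n - i.+1) = 2 ^+ n - 1 :> int.
Proof.
elim: n => [|n IHn]; first by rewrite big_ord0 expr0 subrr.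
by rewrite big_ord_recl subn1 /= IHn exprS; ring.
Qed.

Lemma pow2_order (q m : nat) : (0 < m)%N -> (2 ^ m = q.+1)%N -> is_mult_order q 2 m.
Proof.
move=> m0 qE; have q1 : (0 < q)%N.
  by have : (2 ^ 0 < 2 ^ m)%N; [rewrite ltn_exp2l | rewrite qE; lia].
split=> // [|j j0 jq]; first by rewrite qE -(addn1 q) modnDl.
rewrite leqNgt; apply/negP => jm.
have j_lt : (2 ^ j < 2 ^ m)%N by rewrite ltn_exp2l.
have j_gt : (2 ^ 0 < 2 ^ j)%N by rewrite ltn_exp2l.
have : (q %| 2 ^ j - 1)%N by rewrite -eqn_mod_dvd ?expn_gt0 //; apply/eqP.
by move/dvdn_leq; rewrite qE in j_lt; lia.
Qed.

Lemma sum_cyclic (V : nmodType) (T : Type) (F : T -> V) (kk : nat -> T) (n : nat) :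
  kk n = kk 0%N -> \sum_(i < n) F (kk i.+1) = \sum_(i < n) F (kk i).
Proof.
case: n => [|n] kkn; first by rewrite !big_ord0.
by rewrite big_ord_recr [RHS]big_ord_recl /= kkn addrC.
Qed.

(* The index k : 'I_m runs over 0, ..., m - 1, so the exponents m - k and
   k - 1 of the 1-based numbering become m - k.+1 and k. *)
Theorem theorem4p7 (q m : nat) (p : 'I_m -> nat) (r : 'I_m -> int)
  (hq : (3 <= q)%N)
  (hm : (3 <= m <= 5)%N)
  (p_inj : injective p)
  (p_range : forall k : 'I_m, (0 < p k < q)%N)
  (hgcd : gcdn q (\big[gcdn/0%N]_(k < m) p k) = 1%N)
  (hsub : forall I : {set 'I_m}, I != finset.set0 ->
     I \proper [set: 'I_m]%SET ->
     (\sum_(i in I) p i <> 0 %[mod q])%N) :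
  perfect_covering (fun k : 'I_m => beatty (p k) q (r k)) <->
  (odd q /\ is_mult_order q 2 m) /\
  (exists (s : 'S_m) (delta gamma deltabar : int),
    [/\ coprimez delta q%:Z,
        (delta * deltabar = 1 %[mod q%:Z])%Z
      & forall k : 'I_m,
          ((p (s k))%:Z = delta * 2 ^+ (m - k.+1) %[mod q%:Z])%Z /\
          (r (s k) = gamma - deltabar * 2 ^+ k %[mod q%:Z])%Z]).
Proof.
split; last first.
  move=> [[q_odd [_ pow_m _]] [s [delta [gamma [deltabar [_ dd prs]]]]]].
  exact: cover_of_doubling dd prs.
move=> [c cov].
have q0 : (0 < q)%N by apply: leq_trans hq.
have m0 : (0 < #|'I_m|)%N by rewrite card_ord; lia.
(* A pair is a proper subset because [m] is at least 3. *)
have p_opp k l : k != l -> (p k + p l)%N != q.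
  move=> kl; apply/eqP => kl_q; apply: (hsub [set k; l]%SET).
  - by apply/finset.set0Pn; exists k; rewrite !inE eqxx.
  - by rewrite properEcard finset.subsetT cardsT card_ord cards2 kl /=; lia.
  - rewrite (bigD1 k) ?inE ?eqxx //= (bigD1 l) ?inE ?eqxx ?orbT 1?eq_sym ?kl //=.
    rewrite big1 => [|j]; first by rewrite addn0 kl_q modnn mod0n.
    by rewrite !inE; case: eqP => // _; case: eqP.
pose Q := (\max_k period q (p k))%N.
have [k0 k0Q] : {k0 | Q = period q (p k0)} by apply: bigop.eq_bigmax.
have Q_dvd : (Q %| q)%N by rewrite k0Q /period dvdn_div ?dvdn_gcdr.
pose g := (q %/ Q)%N.
have qE : q = (g * Q)%N by rewrite divnK.
have mp : max_period q Q g p.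
  split=> //.
  - rewrite k0Q /period ltn_divRL ?dvdn_gcdr // mul1n.
    have /andP[p0 pq] := p_range k0; apply: leq_ltn_trans pq.
    by rewrite dvdn_leq ?dvdn_gcdl.
  - by move: q0; rewrite {1}qE muln_gt0 => /andP[].
  - by move=> k; rewrite /Q (bigop.leq_bigmax k).
have k0K : top q Q p k0 by rewrite /top -k0Q.
have g_of_full : top q Q p =1 xpredT -> g = 1%N.
  move=> full; have gk k : (g %| p k)%N.
    have <- := period_gcd qE (ltnW (mp_Q mp)) (eqP (full k : top q Q p k)).
    exact: dvdn_gcdl.
  apply/eqP; rewrite -dvdn1 -hgcd dvdn_gcd {1}qE dvdn_mulr //=.
  by elim/big_ind: _ => // x y gx gy; rewrite dvdn_gcd gx.
pose n := #|top q Q p|.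
have n_m : (n <= m)%N by rewrite -[X in (_ <= X)%N]card_ord max_card.
have full_of_card : n = m -> top q Q p =1 xpredT.
  move=> nm k; apply: contraT => kK.
  have : (#|top q Q p| < #|[pred x : 'I_m | true]|)%N.
    by apply: proper_card; apply/properP; split; [exact/fintype.subsetP | exists k].
  by rewrite -/n nm (_ : #|_| = m) ?ltnn // -[RHS]card_ord; apply: eq_card.
have g_gcd k : top q Q p k -> gcdn (p k) q = g.
  by move/eqP; apply: period_gcd qE (ltnW (mp_Q mp)).
(* Five contributing sets are all the sets, so [g = 1] and [Q = q]; the finite search then excludes
   [Q < 24]. *)
have card_ok : (n <= 4)%N || (n == 5) && (24 <= Q)%N.
  have [//|n4] := leqP n 4; have nm : n = m by lia.
  have m5 : m = 5 by lia.
  have g1 := g_of_full (full_of_card nm); rewrite nm m5 eqxx /= leqNgt.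
  apply/negP => Q24; have qQ : q = Q by rewrite qE g1 mul1n.
  have p_cop k : coprime (p k) q.
    by rewrite /coprime g_gcd ?g1 //; apply: full_of_card nm k.
  have /beatty_coverE-/(_ p_range) cov' := cov.
  apply: (no_small_five_cover m5 _ p_inj p_range p_cop _ cov'); first by lia.
  move=> k l; have [<-|kl] := eqVneq k l; last exact/eqP/p_opp.
  have /eqP := p_cop k; rewrite addnn -muln2 => pk1 pk2.
  by move: pk1; rewrite -pk2 gcdnMr; lia.
have [Qn [kk [kkn kk0 kk_perm kk_p kk_r]]] :=
  top_structure Rdefinitions.R mp k0K cov card_ok.
rewrite -/n in Qn kkn kk_perm kk_p kk_r.
have n0 : (0 < n)%N by apply/card_gt0P; exists k0.
have kkK i : (i < n)%N -> top q Q p (kk i).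
  move=> i_n; rewrite -[top _ _ _ _]/(kk i \in top q Q p) -mem_enum (perm_mem kk_perm).
  by apply/mapP; exists i; rewrite ?mem_iota.
have kkSK i : (i < n)%N -> top q Q p (kk i.+1).
  rewrite leq_eqVlt => /orP[/eqP ->|]; last exact: kkK.
  by rewrite kkn kkK.
have Qn_int : 2 ^+ n = Q%:Z + 1 :> int.
  by rewrite -[RHS]/((Q + 1)%N%:Z) addn1 -Qn -[RHS]natz natrX.
(* [Q] annihilates [p (kk i.+1)] modulo [q], so [2 ^+ n = Q + 1] acts on it as 1 and dividing by
   [2 ^+ i.+1] becomes multiplying by [2 ^+ (n - i.+1)]. *)
have kk_pow i : (i < n)%N ->
    (q%:Z %| (p (kk i.+1))%:Z - (p k0)%:Z * 2 ^+ (n - i.+1))%Z.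
  move=> i_n; have /dvdzP[t tE] := kk_p i i_n.
  have /dvdzP[u uE] := dvdz_mul_period 1 mp (kkSK i i_n).
  apply/dvdzP; exists (t * 2 ^+ (n - i.+1) - u).
  have powE : 2 ^+ i.+1 * 2 ^+ (n - i.+1) = Q%:Z + 1 :> int.
    by rewrite -Qn_int -exprD subnKC.
  have -> : (p (kk i.+1))%:Z - (p k0)%:Z * 2 ^+ (n - i.+1) =
      ((p (kk i.+1))%:Z * 2 ^+ i.+1 - (p k0)%:Z) * 2 ^+ (n - i.+1) -
      (p (kk i.+1))%:Z * (1 * Q%:Z).
    transitivity ((p (kk i.+1))%:Z * (Q%:Z + 1) - (p k0)%:Z * 2 ^+ (n - i.+1) -
      (p (kk i.+1))%:Z * (1 * Q%:Z)); first by ring.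
    by rewrite -powE; ring.
  by rewrite tE uE; ring.
(* Modulo [q] the contributing weights are [p k0] times the powers of two below [2 ^+ n], whose sum
   is [Q]. Their total is 0 modulo [q], so they cannot form a proper subset. *)
have full : top q Q p =1 xpredT.
  pose I : {set 'I_m} := finset.finset (top q Q p).
  have [IT|IT] := eqVneq I [set: 'I_m]%SET.
    move=> k; have : k \in I by rewrite IT inE.
    by rewrite inE.
  case: (hsub I); last 1 first.
  - have -> : (\sum_(i in I) p i = \sum_(i < n) p (kk i.+1))%N.
      rewrite -[RHS]/(\sum_(i < n) p (kk i.+1)) (sum_cyclic p kkn).
      rewrite (eq_bigl (top q Q p)) => [|k]; last by rewrite inE.
      rewrite -big_filter deprecated_filter_index_enum (perm_big _ kk_perm).
      by rewrite big_map -[n in iota _ n]subn0 big_mkord.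
    have : (q%:Z %| (\sum_(i < n) p (kk i.+1))%N%:Z - (p k0)%:Z * (1 * Q%:Z))%Z.
      have -> : (1 * Q%:Z) = \sum_(i < n) 2 ^+ (n - i.+1).
        by rewrite sum_pow2_rev Qn_int; ring.
      rewrite -[X in X - _]natz natr_sum mulr_sumr -sumrB.
      by apply: rpred_sum => i _; rewrite natz; apply: kk_pow.
    rewrite rpredBr; last exact: dvdz_mul_period mp k0K.
    by move=> qS; rewrite mod0n; apply/eqP; exact: qS.
  - by apply/finset.set0Pn; exists k0; rewrite inE.
  - by rewrite finset.properT.
have nm : n = m.
  by rewrite /n -[RHS]card_ord; apply: eq_card => k; rewrite inE; exact: full.
have g1 := g_of_full full; have qQ : q = Q by rewrite qE g1 mul1n.
rewrite nm -qQ in Qn kkn kk_perm kk_p kk_r n0 kkSK Qn_int kk_pow.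
rewrite g1 divn1 in kk_r.
have cop0 : coprime (p k0) q by rewrite /coprime g_gcd ?g1.
split; [split|].
- have /(congr1 odd) := Qn; rewrite oddX /= orbF.
  by case: (m) n0 => //= m' _ /esym/negbFE.
- exact: pow2_order.
have [/= v [w vw]] := Bezoutz (p k0) q.
have dd : v * (p k0)%:Z = 1 - w * q%:Z.
  have gE : gcdz (p k0) q = 1 by rewrite /gcdz /= (eqP cop0).
  by move: vw; rewrite gE => <-; ring.
(* The indices 1 to [m] run over the same cycle as 0 to [m - 1], since [kk m] is [kk 0]; [idx] moves
   them back below [m]. *)
have kk_inj : injective (fun i : 'I_m => kk i.+1).
  pose idx (i : nat) := if i.+1 == m then 0%N else i.+1.
  have idxE i : kk i.+1 = kk (idx i) by rewrite /idx; case: eqP => // ->.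
  have kk_uniq : uniq [seq kk i | i <- iota 0 m].
    by rewrite -(perm_uniq kk_perm) enum_uniq.
  have idx_lt (i : 'I_m) : (idx i < m)%N.
    by rewrite /idx; have := ltn_ord i; case: eqP; lia.
  move=> i j; rewrite !idxE => kij; apply: ord_inj.
  have : nth k0 [seq kk i | i <- iota 0 m] (idx i) =
      nth k0 [seq kk i | i <- iota 0 m] (idx j).
    by rewrite !(nth_map 0%N) ?size_iota // !nth_iota.
  move/eqP; rewrite nth_uniq ?size_map ?size_iota // => /eqP.
  by rewrite /idx; case: eqP; case: eqP; lia.
(* [v] is the Bezout inverse of [p k0]. As [kk m] is [k0], this index takes the last position, where
   [r k0 = gamma - v * 2 ^+ m.-1] determines [gamma]. *)
exists (perm kk_inj), (p k0)%:Z, (r k0 + v * 2 ^+ m.-1), v.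
split; first exact: cop0.
  by apply/eqz_modP; exists (- w); rewrite mulrC dd; ring.
move=> i; rewrite permE; split; apply/eqP; rewrite eqz_mod_dvd.
  exact: kk_pow.
have /dvdzP[t tE] := kk_r i (ltn_ord i).
apply/dvdzP; exists (v * t + w * (r (kk i.+1) - r k0)).
transitivity (v * ((p k0)%:Z * (r (kk i.+1) - r k0) + 2 ^+ i - 2 ^+ m.-1) +
  (1 - v * (p k0)%:Z) * (r (kk i.+1) - r k0)); first by ring.
by rewrite tE dd; ring.
Qed.
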